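(* (i) For every integer $k\ge 0$ there is a constant $C_k>0$ such that $$\left|\frac{\partial_t^kF(0,x_n+2^{-n})-\partial_t^kF(0,x_n)}{F(0,x_n+2^{-n})-F(0,x_n)}\right|\le C_k\,n^k ,\qquad x\in[0,1),\ n\ge1.$$ (ii) $\partial_t^kF(0,x)$ is well defined for every $x\in[0,1]\setminus D$ (and every $k\ge0$). (iii) Let $C_k$ be the constant in (i). Then $$\left|\frac{\partial_t^kF(0,x)-\partial_t^kF(0,y)}{F(0,x)-F(0,y)}\right|\le C_k\,(-\log_2|x-y|)^k ,\qquad x,y\in[0,1],\ x\ne y.$$
   Context: Let $E\subset\mathbb{R}^3$ be the set of $(b,u,v)$ with $0<b<1$, $b-1<u<\frac1b-1$, $-b<v<\frac{b}{1-b}$, and such that $(1+v)(1-b(1+u))^2<1-b$ or $(b+v)^2<b(1+u)(1+v)$. Fix an open interval $I\ni 0$ and a smooth ($C^\infty$) curve $t\mapsto(b_1(t),c_0(t),c_1(t))\in E$, $t\in I$. For $A=\begin{pmatrix}a&b\\c&d\end{pmatrix}$ put $\Phi(A;z)=\frac{az+b}{cz+d}$, and let $$A_0(t)=\begin{pmatrix}b_1(t)(1+c_0(t))&0\\c_0(t)&1\end{pmatrix},\quad A_1(t)=\begin{pmatrix}1-b_1(t)+c_1(t)&b_1(t)\\c_1(t)&1\end{pmatrix}.$$ For $t\in I$, $F(t,\cdot)$ is the unique continuous $f:[0,1]\to[0,1]$ with $f(x)=\Phi(A_0(t);f(2x))$ for $0\le x\le\frac12$ and $f(x)=\Phi(A_1(t);f(2x-1))$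 for $\frac12\le x\le1$; it is strictly increasing with $F(t,0)=0$, $F(t,1)=1$. For $x\in[0,1)$, $X_i(x)\in\{0,1\}$ is the $i$-th binary digit of $x$ (for dyadic rationals the expansion with finitely many $1$'s is used) and $x_n=\sum_{i=1}^nX_i(x)2^{-i}$. $D=\bigcup_{n\ge1}\{k/2^n:1\le k\le 2^n-1\}$. (At points of $D\cup\{0,1\}$ the function $t\mapsto F(t,x)$ is a finite sum of smooth functions, so $\partial_t^kF(0,x)$ exists there.) $\partial_t^kF(0,x)$ is the $k$-th derivative of $t\mapsto F(t,x)$ at $t=0$, and $\partial_t^0F=F$.
   Formalization: In (iii) the factor (-log_2|x-y|)^k is replaced by max(1, -log_2|x-y|)^k, since the printed bound fails for k=1 as |x-y| tends to 1 (e.g. b_1=1/2+t, c_0=c_1=0, x=1-2^{-n}, y=0); it is unchanged for |x-y|<=1/2 or k=0. *)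

(* Defs.v *)
From Stdlib Require Import Reals ZArith Lra Lia.
From Coquelicot Require Import Coquelicot.
Open Scope R_scope.

Definition param_set_E (b u v : R) : Prop :=
  0 < b < 1 /\
  b - 1 < u < 1 / b - 1 /\
  - b < v < b / (1 - b) /\
  ((1 + v) * (1 - b * (1 + u)) ^ 2 < 1 - b \/
   (b + v) ^ 2 < b * (1 + u) * (1 + v)).

(* The matrix (a b; c d) is mk_mat2 a b c d. *)
Record mat2 : Type := mk_mat2 { m11 : R; m12 : R; m21 : R; m22 : R }.

Definition Phi (A : mat2) (z : R) : R :=
  (m11 A * z + m12 A) / (m21 A * z + m22 A).

Definition mat_A0 (b u v : R) : mat2 := mk_mat2 (b * (1 + u)) 0 u 1.
Definition mat_A1 (b u v : R) : mat2 := mk_mat2 (1 - b + v) b v 1.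

Definition unit_interval (x : R) : Prop := 0 <= x <= 1.

Definition de_rham_solution (M0 M1 : mat2) (f : R -> R) : Prop :=
  continuous_on unit_interval f /\
  (forall x, unit_interval x -> unit_interval (f x)) /\
  (forall x, 0 <= x <= 1 / 2 -> f x = Phi M0 (f (2 * x))) /\
  (forall x, 1 / 2 <= x <= 1 -> f x = Phi M1 (f (2 * x - 1))).

(* The endpoints may be infinite. *)
Definition ext_open_interval (lo hi : Rbar) (t : R) : Prop :=
  Rbar_lt lo t /\ Rbar_lt t hi.

Definition smooth_on (J : R -> Prop) (g : R -> R) : Prop :=
  forall (n : nat) (t : R), J t -> ex_derive_n g n t.

(* Derive_n is total, so ex_derive_n g k t alone would allow the lower order
   derivatives to be junk values near t; they are required to exist there. *)
Definition kth_derivative_well_defined (g : R -> R) (k : nat) (t : R) : Prop :=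
  locally t (fun s => forall j, (j < k)%nat -> ex_derive_n g j s) /\
  ex_derive_n g k t.

(* The k-th derivative in t of F(t, x) at t = 0. *)
Definition dF (F : R -> R -> R) (k : nat) (x : R) : R :=
  Derive_n (fun t => F t x) k 0.

(* Int_part is the floor, so for x in [0, 1) this picks, at dyadic x, the
   expansion with finitely many 1's; see digit_trunc_bounds. *)
Definition digit (i : nat) (x : R) : Z := (Int_part (2 ^ i * x) mod 2)%Z.

Definition digit_trunc (n : nat) (x : R) : R :=
  sum_n_m (fun i => IZR (digit i x) * / 2 ^ i) 1 n.

Definition dyadic_interior (x : R) : Prop :=
  exists n k : nat,
    (1 <= n)%nat /\ (1 <= k <= 2 ^ n - 1)%nat /\ x = INR k / 2 ^ n.

(* Used as Rmax 1 (- log2 |x - y|): the maximum matters only for |x - y| > 1/2,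
   where - log2 |x - y| by itself tends to 0 as |x - y| tends to 1, too fast
   for a log-Lipschitz bound.  For b1(t) = 1/2 + t and c0 = c1 = 0 one has
   F(t, 1 - 2^-n) = 1 - (1/2 - t)^n, so at x = 1 - 2^-n, y = 0 the quotient of
   first derivatives is n 2^(1-n) / (1 - 2^-n), while - log2 |x - y| is of
   order 2^-n. *)
Definition log2 (r : R) : R := ln r / ln 2.

Lemma digit_01 (i : nat) (x : R) : digit i x = 0%Z \/ digit i x = 1%Z.
Proof. unfold digit; assert (H := Z.mod_pos_bound (Int_part (2 ^ i * x)) 2); lia. Qed.

Lemma digit_trunc_floor (n : nat) (x : R) :
  0 <= x < 1 -> digit_trunc n x = IZR (Int_part (2 ^ n * x)) * / 2 ^ n.
Proof.
intros Hx; unfold digit_trunc; induction n as [|n IH].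
- rewrite sum_n_m_zero by lia; change (zero = IZR (Int_part (1 * x)) * / 1).
  rewrite <- (Int_part_spec (1 * x) 0) by (simpl; lra).
  unfold zero; simpl; lra.
- rewrite sum_n_Sm by lia; rewrite IH.
  unfold digit.
  set (a := Int_part (2 ^ n * x)); set (c := Int_part (2 ^ S n * x)).
  assert (Ha := base_Int_part (2 ^ n * x)); fold a in Ha.
  assert (Hc := base_Int_part (2 ^ S n * x)); fold c in Hc.
  assert (Hd : (c = 2 * a + c mod 2)%Z).
  { assert (H1 : (2 * a <= c < 2 * a + 2)%Z).
    { simpl pow in Hc; split.
      - apply Zlt_succ_le, lt_IZR; unfold Z.succ.
        rewrite plus_IZR, mult_IZR; lra.
      - apply lt_IZR; rewrite plus_IZR, mult_IZR; lra. }
    assert (H := Z.div_mod c 2 ltac:(lia)).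
    assert (Hm := Z.mod_pos_bound c 2 ltac:(lia)). lia. }
  replace (IZR c) with (2 * IZR a + IZR (c mod 2)).
  + change (IZR a * / 2 ^ n + IZR (c mod 2) * / 2 ^ S n
            = (2 * IZR a + IZR (c mod 2)) * / 2 ^ S n).
    simpl; field; apply pow_nonzero; lra.
  + rewrite Hd at 2; rewrite plus_IZR, mult_IZR; reflexivity.
Qed.

Lemma digit_trunc_bounds (n : nat) (x : R) :
  0 <= x < 1 -> digit_trunc n x <= x < digit_trunc n x + / 2 ^ n.
Proof.
intros Hx; rewrite digit_trunc_floor by exact Hx.
assert (H := base_Int_part (2 ^ n * x)).
assert (Hp : 0 < / 2 ^ n) by (apply Rinv_0_lt_compat, pow_lt; lra).
replace x with (2 ^ n * x * / 2 ^ n) at 2 3 by (field; apply pow_nonzero; lra).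
split; nra.
Qed.

(* Main.v *)
(* Let x_w be the left endpoint of the dyadic interval of a digit word w of
   length n, and g_w(t) the increment of F(t, .) over that interval.  On it,
   F(t, x_w + s 2^-n) = F(t, x_w) + g_w y_w F(t, s) / (1 + (y_w - 1) F(t, s)) for a
   single further number y_w(t) > 0, and refining by a digit d multiplies g_w by
   pi_d(t, y_w), where pi_0 = b y / (b y + 1 - b) and pi_1 = 1 - pi_0.  The y_w stay
   in a compact subset of (0, oo), and in the coordinate log y the two maps
   y_w |-> y_wd contract with rates pi_0 and pi_1.  Hence all t-derivatives of the
   y_w are bounded uniformly in w, the logarithmic derivative of g_w is a sum of n
   uniformly bounded terms, and the k-th derivative of g_w is O(n^k) g_w, which is
   (i).  As g_w decays exponentially in n, F(., x) is a limit of functions with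
   uniformly bounded derivatives of every order, which gives (ii).  For (iii),
   [x, y] is covered by a dyadic cell of comparable size, or by two cells with a
   common endpoint whose increments of F are dominated by that over [x, y]. *)

Require Import Defs.
From Stdlib Require Import Reals ZArith Lra Lia List.
From Coquelicot Require Import Coquelicot.
Import ListNotations.
Open Scope R_scope.

(** All bounds must be uniform over words, points of a cell and t at once, and must survive
    differentiation to any order. So the argument runs on families of functions of t on an open set
    whose derivatives up to order k are bounded by constants times a weight of the index. Such
    families are stable under sums, products, reciprocals, limits and recursions along words, and
    each bound of order k + 1 comes from one first-order identity and bounds of order k. Logarithmic
    derivatives make this work: that of y_w satisfies an affine recursion whose rate is uniformly
    below 1, because pi_0 and pi_1 add up to 1 and both stay away from 0; that of g_w is a plain
    sum, and stays O(n) after any number of differentiations. In (iii) the obstacle is depth: if x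
    is very close to the common endpoint of the two cells, the cell fitted to it lies at a level far
    beyond -log_2 |x - y|, and the power of its level alone would be too large a factor. *)

Ltac eta_Derive :=
  repeat match goal with
  | |- context [Derive (fun x => ?f x) ?t] =>
      progress change (Derive (fun x => f x) t) with (Derive f t)
  end.

(** * Families of functions with uniformly bounded derivatives *)

Section BoundedDerivatives.

Context (J : R -> Prop) (HJ : open J).

(** At each order one constant serves all indices; only the weight depends on [i]. Differentiability
    is demanded on all of [J] at every order, so that on the open set [J] the iterated [Derive] are
    true derivatives and not default values. *)
Fixpoint bounded_derivs {I : Type} (k : nat) (wt : I -> R) (f : I -> R -> R) : Prop :=
  (exists M, forall i t, J t -> Rabs (f i t) <= M * wt i) /\
  match k with
  | O => True
  | S k' => (forall i t, J t -> ex_derive (f i) t) /\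
            bounded_derivs k' wt (fun i => Derive (f i))
  end.

Lemma bounded_derivs_bound {I : Type} k wt (f : I -> R -> R) :
  bounded_derivs k wt f -> exists M, forall i t, J t -> Rabs (f i t) <= M * wt i.
Proof. destruct k; intros H; apply H. Qed.

Lemma bounded_derivs_ext {I : Type} k (wt wt' : I -> R) (f g : I -> R -> R) :
  (forall i, wt i = wt' i) -> (forall i t, J t -> f i t = g i t) ->
  bounded_derivs k wt f -> bounded_derivs k wt' g.
Proof.
intros Hw; revert f g; induction k as [|k IH]; intros f g Hfg [[M HM] Hd].
- split; [exists M; intros i t Ht; rewrite <- Hfg, <- Hw by exact Ht; auto | exact Logic.I].
- split; [exists M; intros i t Ht; rewrite <- Hfg, <- Hw by exact Ht; auto |].
  destruct Hd as [Hex Hd]; split.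
  + intros i t Ht; apply (ex_derive_ext_loc (f i)); [|auto].
    apply (filter_imp J); [intros s Hs; auto | apply HJ, Ht].
  + apply (IH (fun i => Derive (f i))); [|exact Hd].
    intros i t Ht; apply Derive_ext_loc.
    apply (filter_imp J); [intros s Hs; auto | apply HJ, Ht].
Qed.

Lemma bounded_derivs_pred {I : Type} k wt (f : I -> R -> R) :
  bounded_derivs (S k) wt f -> bounded_derivs k wt f.
Proof.
revert f; induction k as [|k IH]; intros f [HM [Hex Hd]].
- split; [exact HM | exact Logic.I].
- split; [exact HM | split; [exact Hex | exact (IH _ Hd)]].
Qed.

Lemma bounded_derivs_of_derive {I : Type} k wt (f f' : I -> R -> R) :
  (exists M, forall i t, J t -> Rabs (f i t) <= M * wt i) ->
  (forall i t, J t -> is_derive (f i) t (f' i t)) ->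
  bounded_derivs k wt f' -> bounded_derivs (S k) wt f.
Proof.
intros HM Hd Hf'; split; [exact HM | split].
- intros i t Ht; exists (f' i t); auto.
- apply (bounded_derivs_ext k wt wt f'); auto.
  intros i t Ht; symmetry; apply is_derive_unique; auto.
Qed.

Lemma bounded_derivs_weaken {I : Type} k (wt wt' : I -> R) (C : R) (f : I -> R -> R) :
  (forall i, 0 <= wt i <= C * wt' i) ->
  bounded_derivs k wt f -> bounded_derivs k wt' f.
Proof.
intros Hw.
assert (HB : forall h : I -> R -> R,
  (exists M, forall i t, J t -> Rabs (h i t) <= M * wt i) ->
  exists M, forall i t, J t -> Rabs (h i t) <= M * wt' i).
{ intros h [M HM]; exists (Rabs M * C); intros i t Ht.
  apply Rle_trans with (1 := HM i t Ht).
  specialize (Hw i); assert (H1 := Rle_abs M); assert (H2 := Rabs_pos M).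
  apply Rle_trans with (Rabs M * wt i); nra. }
revert f; induction k as [|k IH]; intros f [HM Hd].
- split; auto.
- destruct Hd as [Hex Hd]; split; auto.
Qed.

(** Pulls a family back along any map of indices: constants become families over words, words are
    replaced by their tails, or an index gains a further component. *)
Lemma bounded_derivs_reindex {I K : Type} (phi : K -> I) k wt (f : I -> R -> R) :
  bounded_derivs k wt f ->
  bounded_derivs k (fun i => wt (phi i)) (fun i => f (phi i)).
Proof.
revert f; induction k as [|k IH]; intros f [[M HM] Hd].
- split; [exists M; auto | exact Logic.I].
- destruct Hd as [Hex Hd]; split; [exists M; auto | split; [auto | exact (IH _ Hd)]].
Qed.

Lemma bounded_derivs_const {I : Type} k wt (c : I -> R) M :
  (forall i, Rabs (c i) <= M * wt i) -> bounded_derivs k wt (fun i _ => c i).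
Proof.
revert c M; induction k as [|k IH]; intros c M Hc.
- split; [exists M; auto | exact Logic.I].
- apply (bounded_derivs_of_derive k wt _ (fun _ _ => 0)); [exists M; auto | |].
  + intros i t _; apply (is_derive_const (c i) t).
  + apply (IH (fun _ => 0) M); intros i.
    rewrite Rabs_R0; apply Rle_trans with (2 := Hc i), Rabs_pos.
Qed.

Lemma bounded_derivs_plus {I : Type} k wt (f g : I -> R -> R) :
  bounded_derivs k wt f -> bounded_derivs k wt g ->
  bounded_derivs k wt (fun i t => f i t + g i t).
Proof.
assert (HB : forall f g : I -> R -> R,
  (exists M, forall i t, J t -> Rabs (f i t) <= M * wt i) ->
  (exists M, forall i t, J t -> Rabs (g i t) <= M * wt i) ->
  exists M, forall i t, J t -> Rabs (f i t + g i t) <= M * wt i).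
{ intros f0 g0 [M1 H1] [M2 H2]; exists (M1 + M2); intros i t Ht.
  apply Rle_trans with (1 := Rabs_triang _ _).
  specialize (H1 i t Ht); specialize (H2 i t Ht); lra. }
revert f g; induction k as [|k IH]; intros f g Hf Hg.
- split; [apply HB; [apply Hf | apply Hg] | exact Logic.I].
- destruct Hf as [Mf [Ef Df]], Hg as [Mg [Eg Dg]].
  apply (bounded_derivs_of_derive k wt _ (fun i t => Derive (f i) t + Derive (g i) t)).
  + auto.
  + intros i t Ht; apply (is_derive_plus (f i) (g i)); apply Derive_correct; auto.
  + exact (IH _ _ Df Dg).
Qed.

Lemma bounded_derivs_mult_wt {I : Type} k wt1 wt2 (f g : I -> R -> R) :
  bounded_derivs k wt1 f -> bounded_derivs k wt2 g ->
  bounded_derivs k (fun i => wt1 i * wt2 i) (fun i t => f i t * g i t).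
Proof.
assert (HB : forall f g : I -> R -> R,
  (exists M, forall i t, J t -> Rabs (f i t) <= M * wt1 i) ->
  (exists M, forall i t, J t -> Rabs (g i t) <= M * wt2 i) ->
  exists M, forall i t, J t -> Rabs (f i t * g i t) <= M * (wt1 i * wt2 i)).
{ intros f0 g0 [M1 H1] [M2 H2]; exists (M1 * M2); intros i t Ht.
  rewrite Rabs_mult.
  replace (M1 * M2 * (wt1 i * wt2 i)) with ((M1 * wt1 i) * (M2 * wt2 i)) by ring.
  apply Rmult_le_compat; auto using Rabs_pos. }
revert f g; induction k as [|k IH]; intros f g Hf Hg.
- split; [apply HB; [apply Hf | apply Hg] | exact Logic.I].
- assert (Hf0 := bounded_derivs_pred _ _ _ Hf).
  assert (Hg0 := bounded_derivs_pred _ _ _ Hg).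
  destruct Hf as [Mf [Ef Df]], Hg as [Mg [Eg Dg]].
  apply (bounded_derivs_of_derive k _ _
    (fun i t => Derive (f i) t * g i t + f i t * Derive (g i) t)).
  + auto.
  + intros i t Ht.
    apply (is_derive_mult (f i) (g i)); [apply Derive_correct; auto .. |].
    intros n m; apply Rmult_comm.
  + apply bounded_derivs_plus; auto.
Qed.

Definition unit_wt {I : Type} : I -> R := fun _ => 1.

Lemma bounded_derivs_mult {I : Type} k wt (f g : I -> R -> R) :
  bounded_derivs k unit_wt f -> bounded_derivs k wt g ->
  bounded_derivs k wt (fun i t => f i t * g i t).
Proof.
intros Hf Hg.
apply (bounded_derivs_ext k (fun i => unit_wt i * wt i) wt (fun i t => f i t * g i t)).
- intros i; apply Rmult_1_l.
- auto.
- apply bounded_derivs_mult_wt; assumption.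
Qed.

Lemma bounded_derivs_opp {I : Type} k wt (f : I -> R -> R) :
  bounded_derivs k wt f -> bounded_derivs k wt (fun i t => - f i t).
Proof.
intros Hf.
apply (bounded_derivs_ext k wt wt (fun i t => -1 * f i t)); [auto | intros; ring |].
apply bounded_derivs_mult; [|exact Hf].
apply (bounded_derivs_const k _ (fun _ => -1) 1).
intros i; unfold unit_wt; rewrite Rabs_left; lra.
Qed.

Lemma bounded_derivs_minus {I : Type} k wt (f g : I -> R -> R) :
  bounded_derivs k wt f -> bounded_derivs k wt g ->
  bounded_derivs k wt (fun i t => f i t - g i t).
Proof.
intros Hf Hg; apply (bounded_derivs_plus k wt f (fun i t => - g i t)); auto.
apply bounded_derivs_opp; exact Hg.
Qed.

Lemma bounded_derivs_cst {I : Type} k (c : R) :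
  bounded_derivs k (@unit_wt I) (fun _ _ => c).
Proof.
apply (bounded_derivs_const k _ (fun _ => c) (Rabs c)).
intros i; unfold unit_wt; lra.
Qed.

(** The derivative of 1/f is - f' (1/f) (1/f), so order k + 1 for 1/f follows from order k for 1/f
    itself and for f'. *)
Lemma bounded_derivs_inv {I : Type} k (f : I -> R -> R) c :
  0 < c -> (forall i t, J t -> c <= f i t) ->
  bounded_derivs k unit_wt f -> bounded_derivs k unit_wt (fun i t => / f i t).
Proof.
intros Hc Hf.
assert (HM : exists M, forall i t, J t -> Rabs (/ f i t) <= M * @unit_wt I i).
{ exists (/ c); intros i t Ht; specialize (Hf i t Ht); unfold unit_wt.
  rewrite Rmult_1_r, Rabs_right.
  - apply Rinv_le_contravar; lra.
  - apply Rle_ge, Rlt_le, Rinv_0_lt_compat; lra. }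
induction k as [|k IH]; intros Hb; [split; auto; exact Logic.I |].
assert (IH' := IH (bounded_derivs_pred _ _ _ Hb)).
destruct Hb as [_ [Ef Df]].
apply (bounded_derivs_of_derive k _ _
  (fun i t => - (Derive (f i) t * (/ f i t * / f i t)))); [exact HM | |].
- intros i t Ht; specialize (Hf i t Ht).
  replace (- (Derive (f i) t * (/ f i t * / f i t)))
    with (- Derive (f i) t / f i t ^ 2) by (field; lra).
  apply is_derive_inv; [apply Derive_correct; auto | lra].
- apply bounded_derivs_opp; repeat apply bounded_derivs_mult; auto.
Qed.

(** [bounded_derivs] peels derivatives off from the inside, [Derive_n] from the outside;
    [Derive_n_comp] reconciles the two. *)
Lemma bounded_derivs_Derive_n {I : Type} j k wt (f : I -> R -> R) :
  (j <= k)%nat -> bounded_derivs k wt f ->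
  (forall i t, J t -> ex_derive_n (f i) j t) /\
  (exists M, forall i t, J t -> Rabs (Derive_n (f i) j t) <= M * wt i).
Proof.
revert k f; induction j as [|j IH]; intros k f Hjk Hf.
- split; [intros; exact Logic.I | apply (bounded_derivs_bound k), Hf].
- destruct k as [|k]; [lia |].
  destruct Hf as [_ [Ef Df]].
  destruct (IH k _ ltac:(lia) Df) as [E [M HM]]; split.
  + intros i t Ht; destruct j as [|j]; [exact (Ef i t Ht) |].
    apply (ex_derive_ext (Derive_n (Derive (f i)) j)); [|exact (E i t Ht)].
    intros s; rewrite <- Nat.add_1_r; exact (Derive_n_comp (f i) j 1 s).
  + exists M; intros i t Ht; specialize (HM i t Ht).
    change (Derive (f i)) with (Derive_n (f i) 1) in HM.
    rewrite Derive_n_comp, Nat.add_1_r in HM; exact HM.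
Qed.

(** * Derivatives of pointwise limits *)

Lemma taylor_one (f : R -> R) M t r h :
  (forall s, Rabs (s - t) < r -> ex_derive f s) ->
  (forall s, Rabs (s - t) < r -> ex_derive (Derive f) s) ->
  (forall s, Rabs (s - t) < r -> Rabs (Derive (Derive f) s) <= M) ->
  Rabs h < r -> Rabs (f (t + h) - f t - h * Derive f t) <= M * h ^ 2.
Proof.
intros E1 E2 HM Hh.
assert (Hsub : forall c, Rabs (c - t) <= Rabs h -> Rabs (c - t) < r).
{ intros c Hc; lra. }
destruct (MVT_cor4 f (Derive f) t (Rabs h)) with (b := t + h) as [c [Hc1 Hc2]].
{ intros c Hc; apply Derive_correct, E1; auto. }
{ replace (t + h - t) with h by ring; lra. }
(* Second use of the mean value theorem, between t and the first intermediate point c; the factor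
   1/2 of Taylor's formula is given up. *)
destruct (MVT_cor4 (Derive f) (Derive (Derive f)) t (Rabs h)) with (b := c)
  as [c' [Hd1 Hd2]].
{ intros s Hs; apply Derive_correct, E2; auto. }
{ replace (t + h - t) with h in Hc2 by ring; lra. }
replace (t + h - t) with h in Hc1, Hc2 by ring.
replace (f (t + h) - f t - h * Derive f t) with ((Derive f c - Derive f t) * h)
  by (rewrite Hc1; ring).
rewrite Hd1, !Rabs_mult.
replace (h ^ 2) with (Rabs h * Rabs h) by (rewrite <- Rabs_mult, Rabs_right; nra).
assert (H1 := HM c' ltac:(apply Hsub; lra)).
rewrite <- Rmult_assoc; apply Rmult_le_compat_r; [apply Rabs_pos |].
apply Rmult_le_compat; auto using Rabs_pos.
Qed.

(* Taylor's formula turns convergence of [f n] at [t] and [t + h] into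
   convergence of the derivatives at [t], up to [O(h)]. *)
Lemma limit_derive (f : nat -> R -> R) (h : R -> R) M t :
  J t ->
  (forall n s, J s -> ex_derive (f n) s) ->
  (forall n s, J s -> ex_derive (Derive (f n)) s) ->
  (forall n s, J s -> Rabs (Derive (Derive (f n)) s) <= M) ->
  (forall s, J s -> is_lim_seq (fun n => f n s) (h s)) ->
  ex_derive h t /\ is_lim_seq (fun n => Derive (f n) t) (Derive h t).
Proof.
intros Ht E1 E2 HM Hlim.
destruct (HJ t Ht) as [r Hr].
assert (Hr' : forall s, Rabs (s - t) < r -> J s) by exact Hr.
assert (HM0 : 0 <= M).
{ apply Rle_trans with (2 := HM 0%nat t Ht), Rabs_pos. }
assert (HT : forall n d, Rabs d < r ->
  Rabs (f n (t + d) - f n t - d * Derive (f n) t) <= M * d ^ 2).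
{ intros n d Hd; apply taylor_one with (r := r); auto. }
assert (Hin : forall d, Rabs d < r -> J (t + d)).
{ intros d Hd; apply Hr'; replace (t + d - t) with d by ring; exact Hd. }
assert (Hcv : ex_finite_lim_seq (fun n => Derive (f n) t)).
{ apply ex_lim_seq_cauchy_corr; intros eps.
  (* With this step the two Taylor remainders, divided by d, are at most eps/4 each; the Cauchy
     property at t and t + d supplies a third eps/4. The denominator has M + 1 because M may be
     0. *)
  set (d := Rmin (r / 2) (eps / (4 * (M + 1)))).
  assert (Hrp := cond_pos r); assert (Hep := cond_pos eps).
  assert (Hd : 0 < d).
  { apply Rmin_glb_lt; [lra | apply Rdiv_lt_0_compat; lra]. }
  assert (Hdr : Rabs d < r).
  { rewrite Rabs_right by lra; assert (H := Rmin_l (r / 2) (eps / (4 * (M + 1)))).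
    fold d in H; lra. }
  assert (HdM : M * d <= eps / 4).
  { assert (H := Rmin_r (r / 2) (eps / (4 * (M + 1)))); fold d in H.
    apply Rle_trans with ((M + 1) * (eps / (4 * (M + 1)))); [nra |].
    right; field; lra. }
  assert (Hdiff := is_lim_seq_minus' _ _ _ _ (Hlim _ (Hin d Hdr)) (Hlim t Ht)).
  assert (Hc := proj1 (ex_lim_seq_cauchy_corr _) (ex_intro (fun l : R => is_lim_seq _ l) _ Hdiff)).
  assert (Hed : 0 < d * eps / 4) by nra.
  destruct (Hc (mkposreal _ Hed)) as [N HN]; simpl in HN.
  exists N; intros n m Hn Hm; specialize (HN n m Hn Hm).
  assert (H1 := HT n d Hdr); assert (H2 := HT m d Hdr).
  apply Rmult_lt_reg_l with d; [exact Hd |].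
  rewrite <- (Rabs_right d) at 1 by lra; rewrite <- Rabs_mult.
  apply Rabs_def2 in HN; apply Rabs_le_between in H1; apply Rabs_le_between in H2.
  assert (M * d ^ 2 <= d * eps / 4) by nra.
  apply Rabs_def1; lra. }
destruct Hcv as [l Hl].
assert (Hd : is_derive h t l).
{ apply is_derive_Reals; intros eps Heps.
  assert (Hrp := cond_pos r).
  set (d := Rmin r (eps / (M + 1))).
  assert (Hd : 0 < d).
  { apply Rmin_glb_lt; [lra | apply Rdiv_lt_0_compat; lra]. }
  exists (mkposreal d Hd); intros e He0 He; simpl in He.
  assert (Her : Rabs e < r) by (apply Rlt_le_trans with (1 := He), Rmin_l).
  assert (HeM : Rabs e < eps / (M + 1)) by (apply Rlt_le_trans with (1 := He), Rmin_r).
  (* The Taylor estimate passes to the limit in n with the same M, and so exhibits l as the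
     derivative of h. *)
  assert (HL : Rabs (h (t + e) - h t - e * l) <= M * e ^ 2).
  { assert (HL := is_lim_seq_minus' _ _ _ _
      (is_lim_seq_minus' _ _ _ _ (Hlim _ (Hin e Her)) (Hlim t Ht))
      (is_lim_seq_mult' _ _ _ _ (is_lim_seq_const e) Hl)).
    apply is_lim_seq_abs in HL.
    exact (is_lim_seq_le _ _ _ _ (fun n => HT n e Her) HL (is_lim_seq_const _)). }
  assert (Hep : 0 < Rabs e) by (apply Rabs_pos_lt; exact He0).
  replace ((h (t + e) - h t) / e - l) with ((h (t + e) - h t - e * l) / e)
    by (field; exact He0).
  rewrite Rabs_div by exact He0.
  apply Rmult_lt_reg_r with (Rabs e); [exact Hep |].
  unfold Rdiv; rewrite Rmult_assoc, Rinv_l, Rmult_1_r by lra.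
  apply Rle_lt_trans with (1 := HL).
  replace (e ^ 2) with (Rabs e * Rabs e) by (rewrite <- Rabs_mult, Rabs_right; nra).
  apply Rmult_lt_compat_r with (r := M + 1) in HeM; [|lra].
  replace (eps / (M + 1) * (M + 1)) with eps in HeM by (field; lra).
  nra. }
split; [exists l; exact Hd |].
rewrite (is_derive_unique _ _ _ Hd); exact Hl.
Qed.

(** Convergence of derivatives is paid for with higher-order bounds on the sequence, whence the
    extra orders in the hypothesis; the application has bounds of all orders. Pointwise convergence
    suffices, without a rate. *)
Lemma bounded_derivs_limit {I : Type} k wt (f : I -> nat -> R -> R) (h : I -> R -> R) :
  bounded_derivs (S (S k)) (fun i : I * nat => wt (fst i)) (fun i => f (fst i) (snd i)) ->
  (forall i t, J t -> is_lim_seq (fun n => f i n t) (h i t)) ->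
  bounded_derivs k wt h.
Proof.
assert (HB : forall (f : I -> nat -> R -> R) (h : I -> R -> R),
  (exists M, forall (i : I * nat) t, J t ->
    Rabs (f (fst i) (snd i) t) <= M * wt (fst i)) ->
  (forall i t, J t -> is_lim_seq (fun n => f i n t) (h i t)) ->
  exists M, forall i t, J t -> Rabs (h i t) <= M * wt i).
{ intros f0 h0 [M HM] Hl; exists M; intros i t Ht.
  exact (is_lim_seq_le _ _ _ _ (fun n => HM (i, n) t Ht)
    (is_lim_seq_abs _ _ (Hl i t Ht)) (is_lim_seq_const (M * wt i))). }
revert f h; induction k as [|k IH]; intros f h Hf Hl.
- split; [apply (HB f); auto; apply Hf | exact Logic.I].
- assert (Hf' := Hf).
  destruct Hf' as [M0 [E0 [M1 [E1 H2]]]].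
  destruct (bounded_derivs_bound _ _ _ H2) as [M HM].
  assert (HD : forall i t, J t ->
    ex_derive (h i) t /\ is_lim_seq (fun n => Derive (f i n) t) (Derive (h i) t)).
  { intros i t Ht; apply (limit_derive (f i) (h i) (M * wt i)); auto.
    - intros n; exact (E0 (i, n)).
    - intros n; exact (E1 (i, n)).
    - intros n; exact (HM (i, n)). }
  split; [apply (HB f); auto | split; [intros; apply HD; auto |]].
  apply (IH (fun i n => Derive (f i n))).
  + apply Hf.
  + intros; apply HD; auto.
Qed.

(** * Families indexed by binary words *)

Lemma Derive_zero_on (f : R -> R) t :
  J t -> (forall s, J s -> f s = 0) -> Derive f t = 0.
Proof.
intros Ht Hf; rewrite (Derive_ext_loc f (fun _ => 0)); [apply Derive_const |].
apply (filter_imp J); [exact Hf | apply HJ, Ht].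
Qed.

Lemma ex_derive_zero_on (f : R -> R) t :
  J t -> (forall s, J s -> f s = 0) -> ex_derive f t.
Proof.
intros Ht Hf; apply (ex_derive_ext_loc (fun _ => 0)); [|apply ex_derive_const].
apply (filter_imp J); [intros s Hs; symmetry; auto | apply HJ, Ht].
Qed.

Lemma is_derive_ext_on (f g : R -> R) t l :
  J t -> (forall s, J s -> f s = g s) -> is_derive g t l -> is_derive f t l.
Proof.
intros Ht Hf; apply is_derive_ext_loc.
apply (filter_imp J); [intros s Hs; symmetry; auto | apply HJ, Ht].
Qed.

(** Lets a family defined by cases on a word be treated one constructor at a time. The three
    constants are replaced by their maximum, which is where [0 <= wt w] enters. *)
Lemma bounded_derivs_cons k wt (h : list bool -> R -> R) :
  (forall w, 0 <= wt w) ->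
  bounded_derivs k (fun _ : unit => wt []) (fun _ => h []) ->
  bounded_derivs k (fun w => wt (false :: w)) (fun w => h (false :: w)) ->
  bounded_derivs k (fun w => wt (true :: w)) (fun w => h (true :: w)) ->
  bounded_derivs k wt h.
Proof.
intros Hw; revert h.
assert (HB : forall h : list bool -> R -> R,
  (exists M, forall (i : unit) t, J t -> Rabs (h [] t) <= M * wt []) ->
  (exists M, forall w t, J t -> Rabs (h (false :: w) t) <= M * wt (false :: w)) ->
  (exists M, forall w t, J t -> Rabs (h (true :: w) t) <= M * wt (true :: w)) ->
  exists M, forall w t, J t -> Rabs (h w t) <= M * wt w).
{ intros h [M1 H1] [M2 H2] [M3 H3].
  exists (Rmax M1 (Rmax M2 M3)).
  assert (L1 := Rmax_l M1 (Rmax M2 M3)).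
  assert (L2 := Rmax_r M1 (Rmax M2 M3)).
  assert (L3 := Rmax_l M2 M3); assert (L4 := Rmax_r M2 M3).
  assert (Hle : forall M w, M <= Rmax M1 (Rmax M2 M3) ->
    M * wt w <= Rmax M1 (Rmax M2 M3) * wt w).
  { intros M w HM; apply Rmult_le_compat_r; auto. }
  intros [|[|] w] t Ht; eapply Rle_trans.
  - exact (H1 tt t Ht).
  - apply Hle; lra.
  - exact (H3 w t Ht).
  - apply Hle; lra.
  - exact (H2 w t Ht).
  - apply Hle; lra. }
induction k as [|k IH]; intros h H1 H2 H3.
- split; [apply HB; [apply H1 | apply H2 | apply H3] | exact Logic.I].
- destruct H1 as [M1 [E1 D1]], H2 as [M2 [E2 D2]], H3 as [M3 [E3 D3]].
  split; [apply HB; auto | split].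
  + intros [|[|] w]; [exact (E1 tt) | exact (E3 w) | exact (E2 w)].
  + apply IH; auto.
Qed.

(** Order 0 is a geometric series: |M| / (1 - theta) is the fixed point of r -> theta r + |M|. The
    derivative of z obeys a recursion with the same contracting coefficient a and forcing a' z + c',
    which contains z only to an order already bounded. *)
Lemma bounded_derivs_affine_rec k theta (a c z : list bool -> R -> R) :
  0 <= theta < 1 ->
  (forall w t, J t -> Rabs (a w t) <= theta) ->
  bounded_derivs k unit_wt a -> bounded_derivs k unit_wt c ->
  (forall t, J t -> z [] t = 0) ->
  (forall d w t, J t -> z (d :: w) t = a (d :: w) t * z w t + c (d :: w) t) ->
  bounded_derivs k unit_wt z.
Proof.
intros Hth Ha; revert c z.
assert (HB : forall c z : list bool -> R -> R,
  (exists M, forall w t, J t -> Rabs (c w t) <= M * @unit_wt (list bool) w) ->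
  (forall t, J t -> z [] t = 0) ->
  (forall d w t, J t -> z (d :: w) t = a (d :: w) t * z w t + c (d :: w) t) ->
  exists M, forall w t, J t -> Rabs (z w t) <= M * @unit_wt (list bool) w).
{ intros c z [M HM] H0 Hz; exists (Rabs M / (1 - theta)).
  unfold unit_wt in *; intros w t Ht; rewrite Rmult_1_r.
  assert (HP : 0 <= Rabs M / (1 - theta)).
  { apply Rdiv_le_0_compat; [apply Rabs_pos | lra]. }
  induction w as [|d w IHw]; [rewrite H0, Rabs_R0; auto |].
  rewrite Hz by exact Ht.
  apply Rle_trans with (1 := Rabs_triang _ _); rewrite Rabs_mult.
  specialize (HM (d :: w) t Ht); rewrite Rmult_1_r in HM.
  assert (HM' := Rle_abs M).
  replace (Rabs M / (1 - theta))
    with (theta * (Rabs M / (1 - theta)) + Rabs M) by (field; lra).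
  apply Rplus_le_compat; [|lra].
  apply Rmult_le_compat; auto using Rabs_pos. }
induction k as [|k IH]; intros c z Hba Hbc H0 Hz.
- split; [apply (HB c); auto; apply Hbc | exact Logic.I].
- assert (Hba' := bounded_derivs_pred _ _ _ Hba).
  assert (Hbz := IH c z Hba' (bounded_derivs_pred _ _ _ Hbc) H0 Hz).
  destruct Hba as [_ [Ea Da]], Hbc as [_ [Ec Dc]].
  assert (Ez : forall w t, J t -> ex_derive (z w) t).
  { induction w as [|d w IHw]; intros t Ht; [apply ex_derive_zero_on; auto |].
    apply (ex_derive_ext_loc (fun t => a (d :: w) t * z w t + c (d :: w) t)).
    - apply (filter_imp J); [intros s Hs; symmetry; auto | apply HJ, Ht].
    - apply (ex_derive_plus (fun t => a (d :: w) t * z w t) (c (d :: w))); auto.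
      apply (ex_derive_mult (a (d :: w)) (z w)); auto. }
  split; [apply (bounded_derivs_bound k); exact Hbz | split; [exact Ez |]].
  (* The forcing at [d :: w] involves [z w], hence the [tl]. *)
  apply (IH (fun w t => Derive (a w) t * z (tl w) t + Derive (c w) t)); auto.
  + apply bounded_derivs_plus; [|exact Dc].
    apply (bounded_derivs_mult k unit_wt (fun w => Derive (a w)) (fun w => z (tl w))).
    * exact Da.
    * exact (bounded_derivs_reindex (@tl bool) k unit_wt z Hbz).
  + intros t Ht; apply Derive_zero_on; auto.
  + intros d w t Ht; apply is_derive_unique.
    apply (is_derive_ext_on _ (fun t => a (d :: w) t * z w t + c (d :: w) t)); auto.
    auto_derive; [repeat split; auto | simpl; eta_Derive; ring].
Qed.

(** Here nothing contracts, so increments add up: [Om] dominates the sums of [wt] along a word. It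
    is used with the word length and with partial sums of a geometric series. *)
Lemma bounded_derivs_sum_rec k wt Om (q z : list bool -> R -> R) :
  (forall w, 0 <= wt w) -> 0 <= Om [] ->
  (forall d w, Om w + wt (d :: w) <= Om (d :: w)) ->
  bounded_derivs k wt q ->
  (forall t, J t -> z [] t = 0) ->
  (forall d w t, J t -> z (d :: w) t = z w t + q (d :: w) t) ->
  bounded_derivs k Om z.
Proof.
intros Hw HOm0 HOm; revert q z.
assert (HB : forall q z : list bool -> R -> R,
  (exists M, forall w t, J t -> Rabs (q w t) <= M * wt w) ->
  (forall t, J t -> z [] t = 0) ->
  (forall d w t, J t -> z (d :: w) t = z w t + q (d :: w) t) ->
  exists M, forall w t, J t -> Rabs (z w t) <= M * Om w).
{ intros q z [M HM] H0 Hz; exists (Rabs M); intros w t Ht.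
  assert (HP := Rabs_pos M); assert (HM' := Rle_abs M).
  induction w as [|d w IHw]; [rewrite H0, Rabs_R0 by auto; nra |].
  rewrite Hz by exact Ht.
  apply Rle_trans with (1 := Rabs_triang _ _).
  specialize (HM (d :: w) t Ht); specialize (HOm d w); specialize (Hw (d :: w)).
  apply Rle_trans with (Rabs M * Om w + Rabs M * wt (d :: w)); nra. }
induction k as [|k IH]; intros q z Hq H0 Hz.
- split; [apply (HB q); auto; apply Hq | exact Logic.I].
- destruct Hq as [Mq [Eq Dq]].
  assert (Ez : forall w t, J t -> ex_derive (z w) t).
  { induction w as [|d w IHw]; intros t Ht; [apply ex_derive_zero_on; auto |].
    apply (ex_derive_ext_loc (fun t => z w t + q (d :: w) t)).
    - apply (filter_imp J); [intros s Hs; symmetry; auto | apply HJ, Ht].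
    - apply (ex_derive_plus (z w) (q (d :: w))); auto. }
  split; [apply (HB q); auto | split; [exact Ez |]].
  apply (IH (fun w => Derive (q w))); auto.
  + intros t Ht; apply Derive_zero_on; auto.
  + intros d w t Ht; apply is_derive_unique.
    apply (is_derive_ext_on _ (fun t => z w t + q (d :: w) t)); auto.
    apply (is_derive_plus (z w) (q (d :: w))); apply Derive_correct; auto.
Qed.

(** Bernoulli's inequality for c = (1 + h) a. *)
Lemma linear_geometric_bound a c :
  0 < a < c -> exists C, 0 < C /\ forall n, INR (S n) * a ^ n <= C * c ^ n.
Proof.
intros Hac; set (h := c / a - 1).
assert (Hh : 0 < h).
{ unfold h; apply Rlt_0_minus, (Rmult_lt_reg_r a); [lra |].
  unfold Rdiv; rewrite Rmult_assoc, Rinv_l; lra. }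
exists (1 + / h); assert (Hi := Rinv_0_lt_compat h Hh).
split; [lra |].
intros n; assert (HB := poly n h Hh).
replace c with ((1 + h) * a) by (unfold h; field; lra).
rewrite Rpow_mult_distr, <- Rmult_assoc.
apply Rmult_le_compat_r; [apply pow_le; lra |].
rewrite S_INR; assert (Hn := pos_INR n).
apply Rle_trans with ((1 + / h) * (1 + INR n * h)).
- replace ((1 + / h) * (1 + INR n * h)) with (INR n + 1 + / h + INR n * h)
    by (field; lra); nra.
- apply Rmult_le_compat_l; lra.
Qed.

(** Each factor n + 1 is absorbed by moving the base half of the way to c. *)
Lemma polynomial_geometric_bound k a c :
  0 < a < c -> exists C, 0 < C /\ forall n, INR (S n) ^ k * a ^ n <= C * c ^ n.
Proof.
revert a; induction k as [|k IH]; intros a Hac.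
- exists 1; split; [lra |]; intros n; rewrite pow_O, !Rmult_1_l.
  apply pow_incr; lra.
- destruct (linear_geometric_bound a ((a + c) / 2)) as [C1 [P1 H1]]; [lra |].
  destruct (IH ((a + c) / 2)) as [C2 [P2 H2]]; [lra |].
  exists (C1 * C2); split; [apply Rmult_lt_0_compat; lra |].
  intros n; specialize (H1 n); specialize (H2 n).
  assert (Hk : 0 <= INR (S n) ^ k) by apply pow_le, pos_INR.
  change (INR (S n) ^ S k) with (INR (S n) * INR (S n) ^ k).
  replace (INR (S n) * INR (S n) ^ k * a ^ n)
    with (INR (S n) ^ k * (INR (S n) * a ^ n)) by ring.
  apply Rle_trans with (INR (S n) ^ k * (C1 * ((a + c) / 2) ^ n)).
  + apply Rmult_le_compat_l; auto.
  + replace (INR (S n) ^ k * (C1 * ((a + c) / 2) ^ n))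
      with (C1 * (INR (S n) ^ k * ((a + c) / 2) ^ n)) by ring.
    rewrite Rmult_assoc; apply Rmult_le_compat_l; lra.
Qed.

(** * Increments over dyadic intervals *)

(** A uniform form of strict inequalities of [param_set_E]. The last two say that Phi(A_0) contracts
    at its fixed point 0, with multiplier b (1 + u), and Phi(A_1) at its fixed point 1, with
    multiplier (1 - b) / (1 + v). *)
Context (b u v : R -> R) (kap : R) (Hkap : 0 < kap < 1).
Context (Hpar : forall t, J t ->
  kap <= b t /\ kap <= 1 - b t /\ kap <= 1 + u t <= / kap /\
  kap <= 1 + v t <= / kap /\ kap <= 1 - b t * (1 + u t) /\ kap <= b t + v t).
Context (Hb : forall k, bounded_derivs k unit_wt (fun _ : unit => b))
        (Hu : forall k, bounded_derivs k unit_wt (fun _ : unit => u))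
        (Hv : forall k, bounded_derivs k unit_wt (fun _ : unit => v)).

(* A word lists binary digits with the last digit first, so that consing a
   digit refines the dyadic interval.  The Moebius map of a word [w] is
   [z |-> left_val w + gap w * skew w * z / (1 + (skew w - 1) * z)]. *)
Fixpoint skew (w : list bool) (t : R) : R :=
  match w with
  | [] => 1
  | d :: w' =>
      let D := b t * skew w' t + 1 - b t in
      if d then (1 + v t) * skew w' t / D else (1 + u t) * D
  end.

(** Equal to 1 + (y - 1) b with y = [skew w t]: the denominator of the normalised Moebius map of [w]
    at b = F(t, 1/2). Hence [share (false :: w)] is the value of that map at b. *)
Definition den (w : list bool) (t : R) : R := b t * skew w t + 1 - b t.

(** The proportion of the parent's increment that falls to the last digit. The value at the empty
    word, which has no parent, is a default chosen so that [share_bounds] holds for all words. *)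
Definition share (w : list bool) (t : R) : R :=
  match w with
  | [] => / 2
  | d :: w' => if d then (1 - b t) / den w' t else b t * skew w' t / den w' t
  end.

Fixpoint gap (w : list bool) (t : R) : R :=
  match w with
  | [] => 1
  | _ :: w' => gap w' t * share w t
  end.

Fixpoint left_val (w : list bool) (t : R) : R :=
  match w with
  | [] => 0
  | d :: w' => left_val w' t + if d then gap (false :: w') t else 0
  end.

Lemma skew_cons_false w t : skew (false :: w) t = (1 + u t) * den w t.
Proof. reflexivity. Qed.

Lemma skew_cons_true w t : skew (true :: w) t = (1 + v t) * skew w t / den w t.
Proof. reflexivity. Qed.

(** Digit 0 acts on y by an affine map of slope b (1 + u) < 1, digit 1 acts on 1/y by an affine map
    of slope (1 - b) / (1 + v) < 1. The margins in [Hpar] make the interval from kap^2 to kap^(-2)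
    invariant under both. *)
Lemma skew_bounds w t : J t -> kap ^ 2 <= skew w t <= / kap ^ 2.
Proof.
intros Ht; destruct (Hpar t Ht) as (B1 & B2 & [U1 U2] & [V1 V2] & L & W).
assert (K1 : kap * / kap = 1) by (apply Rinv_r; lra).
assert (K2 : 1 < / kap).
{ rewrite <- Rinv_1; apply Rinv_lt_contravar; lra. }
rewrite <- pow_inv; set (K := / kap) in *; clearbody K.
induction w as [|[|] w [IH1 IH2]]; [simpl; nra | |].
- rewrite skew_cons_true; unfold den; set (y := skew w t) in *; clearbody y.
  assert (0 < kap ^ 2) by nra.
  assert (Hy : 0 < b t * y) by nra.
  assert (HD : 0 < b t * y + 1 - b t) by lra.
  split; apply (Rmult_le_reg_r (b t * y + 1 - b t)); auto;
    unfold Rdiv; rewrite (Rmult_assoc ((1 + v t) * y)), Rinv_l, Rmult_1_r by lra.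
  + assert (0 <= y * (b t + v t - b t * kap ^ 2)).
    { apply Rmult_le_pos; [lra |]; nra. }
    assert (0 <= (y - kap ^ 2) * (1 - b t)) by (apply Rmult_le_pos; lra).
    nra.
  + assert (HbK : K <= b t * K ^ 2).
    { replace K with (kap * K ^ 2) at 1
        by (replace (kap * K ^ 2) with ((kap * K) * K) by ring; rewrite K1; ring).
      apply Rmult_le_compat_r; [apply pow2_ge_0 | lra]. }
    assert (0 <= y * (b t * K ^ 2 - (b t + v t))).
    { apply Rmult_le_pos; lra. }
    assert (0 <= (K ^ 2 - y) * (1 - b t)) by (apply Rmult_le_pos; lra).
    nra.
- rewrite skew_cons_false; unfold den; set (y := skew w t) in *; clearbody y.
  assert (HL : 0 <= b t * (1 + u t)) by nra.
  assert (0 <= b t * (1 + u t) * (y - kap ^ 2)) by (apply Rmult_le_pos; lra).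
  assert (0 <= b t * (1 + u t) * (K ^ 2 - y)) by (apply Rmult_le_pos; lra).
  split.
  + assert (kap * kap <= (1 + u t) * (1 - b t)) by (apply Rmult_le_compat; lra).
    assert ((1 - b t * (1 + u t)) * kap ^ 2 <= 1 * kap ^ 2).
    { apply Rmult_le_compat_r; [apply pow2_ge_0 | lra]. }
    nra.
  + assert ((1 + u t) * (1 - b t) <= K * 1) by (apply Rmult_le_compat; lra).
    assert (HK : kap * K ^ 2 = K).
    { replace (kap * K ^ 2) with ((kap * K) * K) by ring; rewrite K1; ring. }
    assert (kap * K ^ 2 <= (1 - b t * (1 + u t)) * K ^ 2).
    { apply Rmult_le_compat_r; [apply pow2_ge_0 | lra]. }
    nra.
Qed.

Lemma skew_pos w t : J t -> 0 < skew w t.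
Proof.
intros Ht; assert (H := skew_bounds w t Ht).
assert (0 < kap ^ 2) by (apply pow_lt; lra); lra.
Qed.

Lemma den_bounds w t : J t -> kap <= den w t <= 2 * / kap ^ 2.
Proof.
intros Ht; assert (H := skew_bounds w t Ht); unfold den.
destruct (Hpar t Ht) as (B1 & B2 & _).
assert (1 < / kap ^ 2).
{ rewrite <- Rinv_1; apply Rinv_lt_contravar; [rewrite Rmult_1_r; apply pow_lt |]; nra. }
nra.
Qed.

(** The product of kap^3, a lower bound for both numerators b y and 1 - b, and kap^2 / 2, a lower
    bound for 1 / [den]. *)
Definition share_min : R := kap ^ 5 / 2.

Lemma share_min_bounds : 0 < share_min < / 2.
Proof.
unfold share_min.
assert (0 < kap ^ 5) by (apply pow_lt; lra).
assert (kap ^ 5 < 1) by (apply pow_lt_1_compat; lra || lia).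
lra.
Qed.

Lemma share_sum w t : J t -> share (false :: w) t + share (true :: w) t = 1.
Proof.
intros Ht; assert (H := den_bounds w t Ht); simpl; unfold den in *; field; lra.
Qed.

(** Only lower bounds are computed; since the two shares add up to 1, each lower bound is an upper
    bound for the other share. *)
Lemma share_bounds w t : J t -> share_min <= share w t <= 1 - share_min.
Proof.
intros Ht; assert (Hm := share_min_bounds).
destruct w as [|d w]; [simpl; lra |].
assert (Hs := share_sum w t Ht).
assert (HH : share_min <= share (false :: w) t /\ share_min <= share (true :: w) t).
{ clear Hs; assert (HD := den_bounds w t Ht); assert (Hy := skew_bounds w t Ht).
  destruct (Hpar t Ht) as (B1 & B2 & _).
  assert (P : 0 < kap ^ 2) by (apply pow_lt; lra).
  assert (Hi : kap ^ 2 / 2 <= / den w t).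
  { replace (kap ^ 2 / 2) with (/ (2 * / kap ^ 2)) by (field; lra).
    apply Rinv_le_contravar; lra. }
  assert (E : share_min = kap ^ 3 * (kap ^ 2 / 2)) by (unfold share_min; field).
  assert (E3 : 0 <= kap ^ 3) by (apply pow_le; lra).
  rewrite E; simpl share; split; unfold Rdiv at 2;
    apply Rmult_le_compat; try lra.
  - replace (kap ^ 3) with (kap * kap ^ 2) by ring.
    apply Rmult_le_compat; lra.
  - assert (kap ^ 3 <= kap) by (replace (kap ^ 3) with (kap * (kap * kap)) by ring; nra).
    lra. }
destruct d; lra.
Qed.

Lemma gap_pos w t : J t -> 0 < gap w t.
Proof.
intros Ht; induction w as [|d w IH]; [simpl; lra |].
assert (H := share_bounds (d :: w) t Ht); assert (Hm := share_min_bounds).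
change (gap (d :: w) t) with (gap w t * share (d :: w) t).
apply Rmult_lt_0_compat; lra.
Qed.

Lemma gap_cons_bounds d w t :
  J t -> share_min * gap w t <= gap (d :: w) t <= (1 - share_min) * gap w t.
Proof.
intros Ht; assert (H := share_bounds (d :: w) t Ht); assert (Hg := gap_pos w t Ht).
change (gap (d :: w) t) with (gap w t * share (d :: w) t); nra.
Qed.

Lemma gap_bounds w t :
  J t -> share_min ^ length w <= gap w t <= (1 - share_min) ^ length w.
Proof.
intros Ht; assert (Hm := share_min_bounds).
induction w as [|d w IH]; [simpl; lra |].
assert (H := gap_cons_bounds d w t Ht).
simpl length; simpl pow; split; [apply Rle_trans with (2 := proj1 H) |
  apply Rle_trans with (1 := proj2 H)]; apply Rmult_le_compat_l; lra.
Qed.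

(** * Derivative bounds of all orders for the cell data *)

Lemma bounded_derivs_cst_family {I : Type} k (f : R -> R) :
  bounded_derivs k unit_wt (fun _ : unit => f) ->
  bounded_derivs k unit_wt (fun _ : I => f).
Proof. exact (bounded_derivs_reindex (fun _ : I => tt) k unit_wt (fun _ => f)). Qed.

Lemma bounded_derivs_Derive_family {I : Type} k (f : R -> R) :
  (forall k, bounded_derivs k unit_wt (fun _ : unit => f)) ->
  bounded_derivs k unit_wt (fun _ : I => Derive f).
Proof.
intros Hf; apply bounded_derivs_cst_family.
destruct (Hf (S k)) as [_ [_ H]]; exact H.
Qed.

(** This and the next lemmas are conditional on order k for [skew], because they serve inside the
    induction on k that proves [bounded_derivs_skew]. *)
Lemma bounded_derivs_den k :
  bounded_derivs k unit_wt skew -> bounded_derivs k unit_wt den.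
Proof.
intros Hs; unfold den.
apply bounded_derivs_minus; [apply bounded_derivs_plus |].
- apply bounded_derivs_mult; [apply bounded_derivs_cst_family, Hb | exact Hs].
- apply bounded_derivs_cst.
- apply bounded_derivs_cst_family, Hb.
Qed.

Lemma bounded_derivs_inv_den k :
  bounded_derivs k unit_wt skew ->
  bounded_derivs k unit_wt (fun w t => / den w t).
Proof.
intros Hs; apply (bounded_derivs_inv k den kap); [lra | |].
- intros w t Ht; apply den_bounds, Ht.
- apply bounded_derivs_den, Hs.
Qed.

Lemma bounded_derivs_share_of_skew k :
  bounded_derivs k unit_wt skew -> bounded_derivs k unit_wt share.
Proof.
intros Hs; assert (Hi := bounded_derivs_inv_den k Hs).
apply bounded_derivs_cons; [intros; unfold unit_wt; lra | | |].
- apply (bounded_derivs_cst k (/ 2)).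
- apply bounded_derivs_mult; [|exact Hi].
  apply bounded_derivs_mult; [apply bounded_derivs_cst_family, Hb | exact Hs].
- apply bounded_derivs_mult; [|exact Hi].
  apply bounded_derivs_minus; [apply bounded_derivs_cst |].
  apply bounded_derivs_cst_family, Hb.
Qed.

(** The logarithmic t-derivative of [skew (d :: w)] with the value of [skew w] held fixed. *)
Definition skew_forcing (w : list bool) (t : R) : R :=
  match w with
  | [] => 0
  | d :: w' =>
      if d then Derive v t * / (1 + v t) - Derive b t * (skew w' t - 1) * / den w' t
      else Derive u t * / (1 + u t) + Derive b t * (skew w' t - 1) * / den w' t
  end.

Lemma bounded_derivs_skew_forcing k :
  bounded_derivs k unit_wt skew -> bounded_derivs k unit_wt skew_forcing.
Proof.
intros Hs; assert (Hi := bounded_derivs_inv_den k Hs).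
assert (HM : bounded_derivs k unit_wt
  (fun w t => Derive b t * (skew w t - 1) * / den w t)).
{ apply bounded_derivs_mult; [|exact Hi].
  apply (bounded_derivs_mult k unit_wt (fun _ => Derive b)).
  - apply bounded_derivs_Derive_family, Hb.
  - apply (bounded_derivs_minus k unit_wt skew (fun _ _ => 1)); [exact Hs |].
    apply bounded_derivs_cst. }
assert (HD : forall f, (forall t, J t -> kap <= 1 + f t) ->
  (forall k, bounded_derivs k unit_wt (fun _ : unit => f)) ->
  bounded_derivs k unit_wt (fun (_ : list bool) t => Derive f t * / (1 + f t))).
{ intros f Hf Hbf; apply (bounded_derivs_mult k unit_wt (fun _ => Derive f)).
  - apply bounded_derivs_Derive_family, Hbf.
  - apply (bounded_derivs_inv k (fun _ t => 1 + f t) kap); [lra | auto |].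
    apply (bounded_derivs_plus k unit_wt (fun _ _ => 1) (fun _ => f)).
    + apply bounded_derivs_cst.
    + apply bounded_derivs_cst_family, Hbf. }
apply bounded_derivs_cons; [intros; unfold unit_wt; lra | | |].
- apply (bounded_derivs_cst k 0).
- apply (bounded_derivs_plus k unit_wt (fun _ t => Derive u t * / (1 + u t)));
    [|exact HM].
  apply HD; [intros t Ht; apply (Hpar t Ht) | exact Hu].
- apply (bounded_derivs_minus k unit_wt (fun _ t => Derive v t * / (1 + v t)));
    [|exact HM].
  apply HD; [intros t Ht; apply (Hpar t Ht) | exact Hv].
Qed.

Lemma ex_derive_b t : J t -> ex_derive b t.
Proof. destruct (Hb 1) as [_ [E _]]; apply (E tt). Qed.
Lemma ex_derive_u t : J t -> ex_derive u t.
Proof. destruct (Hu 1) as [_ [E _]]; apply (E tt). Qed.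
Lemma ex_derive_v t : J t -> ex_derive v t.
Proof. destruct (Hv 1) as [_ [E _]]; apply (E tt). Qed.

(* In logarithmic coordinates the two maps [skew w |-> skew (d :: w)] contract,
   with rates [share (false :: w)] and [share (true :: w)]. *)
Lemma is_derive_skew w t :
  J t ->
  is_derive (skew w) t (Derive (skew w) t) /\
  forall d, Derive (skew (d :: w)) t / skew (d :: w) t =
    share (d :: w) t * (Derive (skew w) t / skew w t) + skew_forcing (d :: w) t.
Proof.
intros Ht; destruct (Hpar t Ht) as (B1 & B2 & [U1 U2] & [V1 V2] & _).
assert (Eb := ex_derive_b t Ht); assert (Eu := ex_derive_u t Ht).
assert (Ev := ex_derive_v t Ht).
assert (HF : forall w, ex_derive (skew w) t ->
  is_derive (skew (false :: w)) t (Derive u t * den w t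
    + (1 + u t) * (Derive b t * skew w t + b t * Derive (skew w) t - Derive b t))).
{ clear w; intros w Ew; change (skew (false :: w)) with (fun t => (1 + u t) * den w t).
  unfold den; auto_derive; [repeat split; auto | eta_Derive; ring]. }
assert (HT : forall w, ex_derive (skew w) t ->
  is_derive (skew (true :: w)) t
    (((Derive v t * skew w t + (1 + v t) * Derive (skew w) t) * den w t
     - (1 + v t) * skew w t *
       (Derive b t * skew w t + b t * Derive (skew w) t - Derive b t)) / den w t ^ 2)).
{ clear w; intros w Ew.
  change (skew (true :: w)) with (fun t => (1 + v t) * skew w t / den w t).
  assert (HD := den_bounds w t Ht); unfold den in *.
  auto_derive; [repeat split; auto; lra | eta_Derive; field; lra]. }
assert (HE : forall w, ex_derive (skew w) t).
{ clear w; induction w as [|[|] w IH]; [apply ex_derive_const | |].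
  - eexists; apply (HT w IH).
  - eexists; apply (HF w IH). }
split; [apply Derive_correct; auto |].
assert (HD := den_bounds w t Ht); assert (Hy := skew_pos w t Ht).
intros [|].
- rewrite (is_derive_unique _ _ _ (HT w (HE w))), skew_cons_true.
  unfold skew_forcing, share; unfold den in *; field; repeat split; lra.
- rewrite (is_derive_unique _ _ _ (HF w (HE w))), skew_cons_false.
  unfold skew_forcing, share; unfold den in *; field; repeat split; lra.
Qed.

(** A bootstrap: order k for [skew] bounds the coefficients [share] and [skew_forcing] to order k,
    the contracting recursion then bounds the logarithmic derivative to order k, and multiplication
    by [skew] yields order k + 1. *)
Lemma bounded_derivs_skew k : bounded_derivs k unit_wt skew.
Proof.
assert (HB : exists M, forall w t, J t -> Rabs (skew w t) <= M * @unit_wt (list bool) w).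
{ exists (/ kap ^ 2); intros w t Ht; unfold unit_wt.
  assert (H := skew_bounds w t Ht); assert (H' := skew_pos w t Ht).
  rewrite Rabs_right; lra. }
assert (Hm := share_min_bounds).
induction k as [|k IH]; [split; [exact HB | exact Logic.I] |].
apply (bounded_derivs_of_derive k _ _
  (fun w t => (Derive (skew w) t / skew w t) * skew w t)); [exact HB | |].
- intros w t Ht; assert (Hy := skew_pos w t Ht).
  unfold Rdiv; rewrite Rmult_assoc, Rinv_l, Rmult_1_r by lra.
  apply is_derive_skew, Ht.
- apply bounded_derivs_mult; [|exact IH].
  apply (bounded_derivs_affine_rec k (1 - share_min) share skew_forcing).
  + lra.
  + intros w t Ht; assert (H := share_bounds w t Ht); rewrite Rabs_right; lra.
  + apply bounded_derivs_share_of_skew, IH.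
  + apply bounded_derivs_skew_forcing, IH.
  + intros t _; change (skew []) with (fun _ : R => 1).
    rewrite Derive_const; unfold Rdiv; ring.
  + intros d w t Ht; apply is_derive_skew, Ht.
Qed.

Lemma bounded_derivs_share k : bounded_derivs k unit_wt share.
Proof. apply bounded_derivs_share_of_skew, bounded_derivs_skew. Qed.

Lemma ex_derive_share w t : J t -> ex_derive (share w) t.
Proof. destruct (bounded_derivs_share 1) as [_ [E _]]; apply E. Qed.

Lemma is_derive_gap w t : J t -> is_derive (gap w) t (Derive (gap w) t).
Proof.
intros Ht; apply Derive_correct; induction w as [|d w IH].
- apply ex_derive_const.
- apply (ex_derive_mult (gap w) (share (d :: w))); [exact IH |].
  apply ex_derive_share, Ht.
Qed.

Definition gap_log_derive (w : list bool) (t : R) : R := Derive (gap w) t / gap w t.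

(** The successor keeps the weight at least 1 even for the empty word, so that its powers increase
    with the exponent. *)
Definition len_wt (w : list bool) : R := INR (S (length w)).

(** [gap] is a product of shares, so this is a sum of one uniformly bounded term per digit. The
    weight is the same at every order: further differentiation costs no further power of the
    length. *)
Lemma bounded_derivs_gap_log_derive k : bounded_derivs k len_wt gap_log_derive.
Proof.
assert (Hm := share_min_bounds).
apply (bounded_derivs_sum_rec k unit_wt len_wt
  (fun w t => Derive (share w) t * / share w t)).
- intros; unfold unit_wt; lra.
- unfold len_wt; apply pos_INR.
- intros d w; unfold len_wt, unit_wt; simpl length; rewrite (S_INR (S _)); lra.
- apply bounded_derivs_mult.
  + destruct (bounded_derivs_share (S k)) as [_ [_ H]]; exact H.
  + apply (bounded_derivs_inv k share share_min); [lra | |].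
    * intros; apply share_bounds; assumption.
    * apply bounded_derivs_share.
- intros t _; unfold gap_log_derive; change (gap []) with (fun _ : R => 1).
  rewrite Derive_const; unfold Rdiv; ring.
- intros d w t Ht; unfold gap_log_derive.
  assert (Hg := gap_pos w t Ht); assert (Hs := share_bounds (d :: w) t Ht).
  assert (HD : is_derive (gap (d :: w)) t
    (Derive (gap w) t * share (d :: w) t + gap w t * Derive (share (d :: w)) t)).
  { apply (is_derive_mult (gap w) (share (d :: w))).
    - apply is_derive_gap, Ht.
    - apply Derive_correct, ex_derive_share, Ht.
    - intros n m; apply Rmult_comm. }
  rewrite (is_derive_unique _ _ _ HD).
  change (gap (d :: w) t) with (gap w t * share (d :: w) t).
  field; lra.
Qed.

Lemma Derive_gap w t : J t -> Derive (gap w) t = gap w t * gap_log_derive w t.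
Proof.
intros Ht; assert (Hg := gap_pos w t Ht); unfold gap_log_derive; field; lra.
Qed.

(** With L the logarithmic derivative of g = [gap], the derivative of g Q is g (L Q + Q'). So g
    stays outside, undifferentiated, while the cofactor gains one power of the length. The general Q
    and j carry the induction; each step spends one order of Q, whence the hypothesis for all m. *)
Lemma gap_mult_Derive_n {I : Type} (wd : I -> list bool) k : forall j (Q : I -> R -> R),
  (forall m, bounded_derivs m (fun i => len_wt (wd i) ^ j) Q) ->
  exists C, forall i t, J t ->
    Rabs (Derive_n (fun s => gap (wd i) s * Q i s) k t)
    <= C * len_wt (wd i) ^ (j + k) * gap (wd i) t.
Proof.
induction k as [|k IH]; intros j Q HQ.
- destruct (bounded_derivs_bound _ _ _ (HQ 0%nat)) as [C HC]; exists C.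
  intros i t Ht; rewrite Nat.add_0_r; change (Derive_n ?f 0 t) with (f t).
  assert (Hg := gap_pos (wd i) t Ht).
  cbv beta; rewrite Rabs_mult, (Rabs_right (gap _ _)), Rmult_comm by lra.
  apply Rmult_le_compat_r; [lra | auto].
- destruct (IH (S j) (fun i t => gap_log_derive (wd i) t * Q i t + Derive (Q i) t))
    as [C HC].
  { intros m; apply bounded_derivs_plus.
    - apply (bounded_derivs_mult_wt m (fun i => len_wt (wd i)) (fun i => len_wt (wd i) ^ j)
        (fun i => gap_log_derive (wd i)) Q); [|apply HQ].
      exact (bounded_derivs_reindex wd m len_wt _ (bounded_derivs_gap_log_derive m)).
    - destruct (HQ (S m)) as [_ [_ H]]; revert H.
      apply (bounded_derivs_weaken m _ _ 1); intros i.
      assert (H1 : 1 <= len_wt (wd i)).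
      { unfold len_wt; rewrite S_INR; assert (H := pos_INR (length (wd i))); lra. }
      assert (Hp : 0 <= len_wt (wd i) ^ j) by (apply pow_le; lra).
      simpl; nra. }
  exists C; intros i t Ht; specialize (HC i t Ht).
  rewrite Nat.add_succ_r; rewrite Nat.add_succ_l in HC.
  rewrite <- Nat.add_1_r, <- Derive_n_comp.
  erewrite Derive_n_ext_loc; [exact HC |].
  apply (filter_imp J); [|apply HJ, Ht].
  intros s Hs; apply is_derive_unique.
  replace (gap (wd i) s * (gap_log_derive (wd i) s * Q i s + Derive (Q i) s))
    with (Derive (gap (wd i)) s * Q i s + gap (wd i) s * Derive (Q i) s)
    by (rewrite Derive_gap by exact Hs; ring).
  apply (is_derive_mult (gap (wd i)) (Q i)).
  + apply is_derive_gap, Hs.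
  + apply Derive_correct; destruct (HQ 1%nat) as [_ [E _]]; apply E, Hs.
  + intros n m; apply Rmult_comm.
Qed.

(** Each derivative brings a factor [len_wt], which a slightly larger base of the exponential
    absorbs; this is why c is arbitrary above 1 - [share_min]. *)
Lemma bounded_derivs_gap k c :
  1 - share_min < c -> bounded_derivs k (fun w => c ^ length w) gap.
Proof.
assert (Hm := share_min_bounds).
revert c; induction k as [|k IH]; intros c Hc.
- split; [|exact Logic.I]; exists 1; intros w t Ht.
  assert (Hg := gap_pos w t Ht); assert (Hb' := gap_bounds w t Ht).
  rewrite Rabs_right, Rmult_1_l by lra; apply Rle_trans with (1 := proj2 Hb').
  apply pow_incr; lra.
- set (a := (1 - share_min + c) / 2).
  assert (Ha : 1 - share_min < a < c) by (unfold a; lra).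
  apply (bounded_derivs_of_derive k _ _ (fun w t => gap_log_derive w t * gap w t)).
  + apply (bounded_derivs_bound k), IH, Hc.
  + intros w t Ht; rewrite Rmult_comm, <- Derive_gap by exact Ht.
    apply is_derive_gap, Ht.
  + destruct (linear_geometric_bound a c) as [C [_ HC]]; [lra |].
    apply (bounded_derivs_weaken k (fun w => len_wt w * a ^ length w) _ C).
    * intros w; split; [|apply HC].
      apply Rmult_le_pos; [apply pos_INR | apply pow_le; lra].
    * apply bounded_derivs_mult_wt; [apply bounded_derivs_gap_log_derive | apply IH; lra].
Qed.

Lemma bounded_derivs_left_val k : bounded_derivs k unit_wt left_val.
Proof.
assert (Hm := share_min_bounds).
set (c := 1 - share_min / 2).
(* The weight is the partial sum of the powers of c, bounded by 1 / (1 - c); c lies strictly between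
   1 - [share_min] and 1. *)
apply (bounded_derivs_weaken k (fun w => (1 - c ^ length w) / (1 - c)) _ (/ (1 - c))).
{ intros w; assert (Hc := pow_lt c (length w) ltac:(unfold c; lra)).
  assert (Hc1 : c ^ length w <= 1).
  { rewrite <- (pow1 (length w)); apply pow_incr; unfold c; lra. }
  assert (Hi : 0 < / (1 - c)) by (apply Rinv_0_lt_compat; unfold c; lra).
  unfold unit_wt, Rdiv; split; [apply Rmult_le_pos; lra |].
  nra. }
apply (bounded_derivs_sum_rec k (fun w => c ^ length w) _
  (fun w t => match w with true :: w' => gap (false :: w') t | _ => 0 end)).
- intros w; apply pow_le; unfold c; lra.
- simpl; unfold Rdiv; lra.
- intros d w; simpl length; simpl pow.
  assert (Hc := pow_lt c (length w) ltac:(unfold c; lra)).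
  assert (Hc1 : c < 1) by (unfold c; lra).
  replace ((1 - c * c ^ length w) / (1 - c))
    with ((1 - c ^ length w) / (1 - c) + c ^ length w) by (field; lra).
  nra.
- assert (H0 : bounded_derivs k (fun w : list bool => c ^ S (length w)) (fun _ _ => 0)).
  { apply (bounded_derivs_const k _ (fun _ => 0) 0); intros w; rewrite Rabs_R0; lra. }
  apply bounded_derivs_cons.
  + intros w; apply pow_le; unfold c; lra.
  + apply (bounded_derivs_const k _ (fun _ => 0) 0); intros w; rewrite Rabs_R0; lra.
  + exact H0.
  + apply (bounded_derivs_reindex (cons false) k (fun w => c ^ length w) gap).
    apply bounded_derivs_gap; unfold c; lra.
- intros; reflexivity.
- intros [|] w t _; reflexivity.
Qed.

(** * The conjugating function *)

Context (F : R -> R -> R).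
Context (HF : forall t, J t ->
  de_rham_solution (mat_A0 (b t) (u t) (v t)) (mat_A1 (b t) (u t) (v t)) (F t)).

Fixpoint left_pt (w : list bool) : R :=
  match w with
  | [] => 0
  | d :: w' => left_pt w' + if d then / 2 ^ S (length w') else 0
  end.

Definition right_pt (w : list bool) : R := left_pt w + / 2 ^ length w.

Lemma half_pow_pos n : 0 < / 2 ^ n.
Proof. apply Rinv_0_lt_compat, pow_lt; lra. Qed.

Lemma half_pow_S n : / 2 ^ S n = / 2 ^ n / 2.
Proof. simpl; field; apply pow_nonzero; lra. Qed.

Lemma left_pt_bounds w : 0 <= left_pt w /\ right_pt w <= 1.
Proof.
unfold right_pt; induction w as [|d w [IH1 IH2]]; [simpl; lra |].
assert (H := half_pow_pos (length w)).
cbn [left_pt length]; rewrite half_pow_S; destruct d; lra.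
Qed.

Lemma F_unit x t : J t -> unit_interval x -> 0 <= F t x <= 1.
Proof. intros Ht; apply (HF t Ht). Qed.

(** The value is a fixed point of Phi(A_0) in [0, 1]. The factor belonging to the other fixed point
    is affine in f and positive at both ends, where it equals 1 - b (1 + u) and (1 + u) (1 - b). For
    [F_1] the corresponding factor v f + b has end values b and b + v. *)
Lemma F_0 t : J t -> F t 0 = 0.
Proof.
intros Ht; destruct (Hpar t Ht) as (B1 & B2 & [U1 U2] & _ & L & _).
assert (H01 := F_unit 0 t Ht ltac:(unfold unit_interval; lra)).
destruct (HF t Ht) as (_ & _ & H & _); specialize (H 0 ltac:(lra)).
rewrite Rmult_0_r in H; unfold Phi in H; simpl in H.
set (f := F t 0) in *; clearbody f.
assert (P : 0 < u t * f + 1) by nra.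
apply (f_equal (Rmult (u t * f + 1))) in H.
replace ((u t * f + 1) * ((b t * (1 + u t) * f + 0) / (u t * f + 1)))
  with (b t * (1 + u t) * f) in H by (field; lra).
assert (Q : 0 < u t * f + 1 - b t * (1 + u t)).
{ assert (0 <= f * ((1 + u t) * (1 - b t))) by
    (apply Rmult_le_pos; [lra | apply Rmult_le_pos; lra]).
  assert (0 <= (1 - f) * (1 - b t * (1 + u t))) by (apply Rmult_le_pos; lra).
  assert (HQ : u t * f + 1 - b t * (1 + u t) =
    f * ((1 + u t) * (1 - b t)) + (1 - f) * (1 - b t * (1 + u t))) by ring.
  destruct (Rle_lt_dec f (/ 2)); [|assert (0 < (1 + u t) * (1 - b t)) by
    (apply Rmult_lt_0_compat; lra)]; nra. }
assert (HZ : f * (u t * f + 1 - b t * (1 + u t)) = 0) by lra.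
apply Rmult_integral in HZ; destruct HZ; lra.
Qed.

Lemma F_1 t : J t -> F t 1 = 1.
Proof.
intros Ht; destruct (Hpar t Ht) as (B1 & B2 & _ & [V1 V2] & _ & W).
assert (H01 := F_unit 1 t Ht ltac:(unfold unit_interval; lra)).
destruct (HF t Ht) as (_ & _ & _ & H); specialize (H 1 ltac:(lra)).
replace (2 * 1 - 1) with 1 in H by ring; unfold Phi in H; simpl in H.
set (f := F t 1) in *; clearbody f.
assert (P : 0 < v t * f + 1) by nra.
apply (f_equal (Rmult (v t * f + 1))) in H.
replace ((v t * f + 1) * (((1 - b t + v t) * f + b t) / (v t * f + 1)))
  with ((1 - b t + v t) * f + b t) in H by (field; lra).
assert (Q : 0 < v t * f + b t) by nra.
assert (HZ : (f - 1) * (v t * f + b t) = 0) by lra.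
apply Rmult_integral in HZ; destruct HZ; lra.
Qed.

(** The increasing Moebius maps of [0, 1] that fix 0 and 1; the parameter y is the derivative at
    0. *)
Definition moebius (y z : R) : R := y * z / (1 + (y - 1) * z).

Lemma moebius_den_pos y z : 0 < y -> 0 <= z <= 1 -> 0 < 1 + (y - 1) * z.
Proof. intros Hy Hz; destruct (Rle_lt_dec z (/ 2)); nra. Qed.

Lemma moebius_le y z z' : 0 < y -> 0 <= z <= z' -> z' <= 1 -> moebius y z <= moebius y z'.
Proof.
intros Hy Hz Hz'; unfold moebius.
assert (P := moebius_den_pos y z Hy ltac:(lra)).
assert (P' := moebius_den_pos y z' Hy ltac:(lra)).
apply Rminus_le_0.
replace (y * z' / (1 + (y - 1) * z') - y * z / (1 + (y - 1) * z))
  with (y * (z' - z) / ((1 + (y - 1) * z') * (1 + (y - 1) * z))) by (field; lra).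
apply Rdiv_le_0_compat; [apply Rmult_le_pos; lra | apply Rmult_lt_0_compat; lra].
Qed.

Lemma moebius_0 y : moebius y 0 = 0.
Proof. unfold moebius; rewrite Rmult_0_r; unfold Rdiv; ring. Qed.

Lemma moebius_1 y : 0 < y -> moebius y 1 = 1.
Proof. intros Hy; unfold moebius; field; lra. Qed.

(** The last digit d acts innermost: the functional equation is applied at (d + s) / 2, and
    [moebius (skew w)] after Phi(A_d) is again an affine image of a normalised Moebius map, whose
    parameter is [skew (d :: w)]. *)
Lemma F_word w s t :
  J t -> unit_interval s ->
  F t (left_pt w + s / 2 ^ length w)
  = left_val w t + gap w t * moebius (skew w t) (F t s).
Proof.
intros Ht; destruct (Hpar t Ht) as (B1 & B2 & [U1 U2] & [V1 V2] & _).
revert s; induction w as [|d w IH]; intros s Hs.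
- simpl; unfold moebius.
  replace (0 + s / 1) with s by field.
  field; lra.
- assert (Hf := F_unit s t Ht Hs).
  destruct (HF t Ht) as (_ & _ & H0 & H1).
  assert (Hy := skew_pos w t Ht); assert (HD := den_bounds w t Ht).
  assert (Hy' := skew_pos (d :: w) t Ht).
  assert (HM := moebius_den_pos _ _ Hy' Hf).
  unfold unit_interval in Hs.
  destruct d.
  + replace (left_pt (true :: w) + s / 2 ^ length (true :: w))
      with (left_pt w + (1 + s) / 2 / 2 ^ length w)
      by (simpl; field; apply pow_nonzero; lra).
    rewrite IH by (unfold unit_interval; lra).
    rewrite (H1 ((1 + s) / 2)) by lra.
    replace (2 * ((1 + s) / 2) - 1) with s by field.
    rewrite skew_cons_true in *.
    change (left_val (true :: w) t) with (left_val w t + gap w t * share (false :: w) t).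
    change (gap (true :: w) t) with (gap w t * share (true :: w) t).
    simpl share; unfold Phi, moebius; simpl.
    set (f := F t s) in *; clearbody f.
    assert (P : 0 < v t * f + 1) by nra.
    assert (P3 : 0 < den w t + ((1 + v t) * skew w t - den w t) * f).
    { replace (den w t + ((1 + v t) * skew w t - den w t) * f)
        with (den w t * (1 + ((1 + v t) * skew w t / den w t - 1) * f)) by (field; lra).
      apply Rmult_lt_0_compat; lra. }
    unfold den in *; field; repeat split; try lra.
  + replace (left_pt (false :: w) + s / 2 ^ length (false :: w))
      with (left_pt w + s / 2 / 2 ^ length w)
      by (simpl; field; apply pow_nonzero; lra).
    rewrite IH by (unfold unit_interval; lra).
    rewrite (H0 (s / 2)) by lra.
    replace (2 * (s / 2)) with s by field.
    rewrite skew_cons_false in *.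
    change (left_val (false :: w) t) with (left_val w t + 0).
    change (gap (false :: w) t) with (gap w t * share (false :: w) t).
    simpl share; unfold Phi, moebius; simpl.
    set (f := F t s) in *; clearbody f.
    assert (P : 0 < u t * f + 1) by nra.
    unfold den in *; field; repeat split; try lra.
Qed.

Lemma F_left_pt w t : J t -> F t (left_pt w) = left_val w t.
Proof.
intros Ht; assert (H := F_word w 0 t Ht ltac:(unfold unit_interval; lra)).
rewrite F_0, moebius_0 in H by exact Ht.
replace (left_pt w + 0 / 2 ^ length w) with (left_pt w) in H
  by (unfold Rdiv; ring).
lra.
Qed.

Lemma F_right_pt w t : J t -> F t (right_pt w) = left_val w t + gap w t.
Proof.
intros Ht; assert (H := F_word w 1 t Ht ltac:(unfold unit_interval; lra)).
rewrite F_1, moebius_1 in H by (try apply skew_pos; exact Ht).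
replace (left_pt w + 1 / 2 ^ length w) with (right_pt w) in H
  by (unfold right_pt, Rdiv; ring).
lra.
Qed.

Lemma F_word_bounds w s t :
  J t -> unit_interval s ->
  left_val w t <= F t (left_pt w + s / 2 ^ length w) <= left_val w t + gap w t.
Proof.
intros Ht Hs; rewrite F_word by assumption.
assert (Hg := gap_pos w t Ht); assert (Hy := skew_pos w t Ht).
assert (Hf := F_unit s t Ht Hs).
assert (H1 := moebius_le (skew w t) 0 (F t s) Hy ltac:(lra) ltac:(lra)).
assert (H2 := moebius_le (skew w t) (F t s) 1 Hy ltac:(lra) ltac:(lra)).
rewrite moebius_0 in H1; rewrite moebius_1 in H2 by exact Hy; nra.
Qed.

(** Digits together with the remainder s in [0, 1]. At the tie s = 1/2 the digit 0 is taken,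
    contrary to [digit], and x = 1 gets digits 1 only, so the closed interval is covered. *)
Fixpoint expand (n : nat) (x : R) : list bool * R :=
  match n with
  | O => ([], x)
  | S n' =>
      let (w, s) := expand n' x in
      if Rle_dec s (/ 2) then (false :: w, 2 * s) else (true :: w, 2 * s - 1)
  end.

Lemma expand_correct n x :
  unit_interval x ->
  length (fst (expand n x)) = n /\ unit_interval (snd (expand n x)) /\
  left_pt (fst (expand n x)) + snd (expand n x) / 2 ^ n = x.
Proof.
intros Hx; induction n as [|n IH].
- simpl; split; [reflexivity | split; [exact Hx | field]].
- simpl expand; destruct (expand n x) as [w s]; simpl fst in *; simpl snd in *.
  destruct IH as (Hl & Hs & E); unfold unit_interval in Hs.
  assert (P : 2 ^ n <> 0) by (apply pow_nonzero; lra).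
  destruct (Rle_dec s (/ 2)) as [H | H]; simpl fst; simpl snd;
    (split; [simpl; lia | split; [unfold unit_interval; lra |]]);
    rewrite <- E; cbn [left_pt]; rewrite ?Hl; simpl; field; exact P.
Qed.

(** The point x is the index, so the bounds are uniform in x; this lets F(t, s) enter as an inner
    function for every s at once in [bounded_derivs_moebius]. *)
Lemma bounded_derivs_F k :
  bounded_derivs k unit_wt (fun (x : {x | unit_interval x}) t => F t (proj1_sig x)).
Proof.
assert (Hm := share_min_bounds).
apply (bounded_derivs_limit k unit_wt
  (fun x n t => left_val (fst (expand n (proj1_sig x))) t)).
- exact (bounded_derivs_reindex
    (fun i : {x | unit_interval x} * nat => fst (expand (snd i) (proj1_sig (fst i))))
    _ unit_wt left_val (bounded_derivs_left_val _)).
- intros [x Hx] t Ht; simpl proj1_sig.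
  apply is_lim_seq_le_le with (u := fun n => F t x - (1 - share_min) ^ n) (w := fun _ => F t x).
  + intros n; destruct (expand_correct n x Hx) as (Hl & Hs & E).
    assert (HB := F_word_bounds (fst (expand n x)) _ t Ht Hs).
    assert (HG := gap_bounds (fst (expand n x)) t Ht).
    rewrite Hl in HB, HG; rewrite E in HB; lra.
  + replace (Finite (F t x)) with (Finite (F t x - 0)) by (f_equal; ring).
    apply is_lim_seq_minus'; [apply is_lim_seq_const |].
    apply is_lim_seq_geom; rewrite Rabs_right; lra.
  + apply is_lim_seq_const.
Qed.

Lemma ex_derive_n_F k x t : J t -> unit_interval x -> ex_derive_n (fun t => F t x) k t.
Proof.
intros Ht Hx.
exact (proj1 (bounded_derivs_Derive_n k k _ _ (le_n k) (bounded_derivs_F k))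
  (exist _ x Hx) t Ht).
Qed.

Lemma bounded_derivs_moebius k :
  bounded_derivs k unit_wt (fun (i : list bool * {x | unit_interval x}) t =>
    moebius (skew (fst i) t) (F t (proj1_sig (snd i)))).
Proof.
assert (HS : bounded_derivs k unit_wt
    (fun i : list bool * {x | unit_interval x} => skew (fst i))).
{ exact (bounded_derivs_reindex fst k unit_wt skew (bounded_derivs_skew k)). }
assert (Hf : bounded_derivs k unit_wt
    (fun (i : list bool * {x | unit_interval x}) t => F t (proj1_sig (snd i)))).
{ exact (bounded_derivs_reindex snd k unit_wt _ (bounded_derivs_F k)). }
unfold moebius; apply bounded_derivs_mult; [apply bounded_derivs_mult; assumption |].
(* The denominator is a convex combination of 1 and y, both at least kap^2. *)
apply (bounded_derivs_inv k _ (kap ^ 2)); [apply pow_lt; lra | |].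
- intros [w [x Hx]] t Ht; simpl fst; simpl snd; simpl proj1_sig.
  assert (HB := F_unit x t Ht Hx); assert (Hy := skew_bounds w t Ht).
  assert (kap ^ 2 < 1) by (apply pow_lt_1_compat; lra || lia).
  nra.
- apply (bounded_derivs_plus k _ (fun _ _ => 1)); [apply bounded_derivs_cst |].
  apply bounded_derivs_mult; [|exact Hf].
  apply bounded_derivs_minus; [exact HS | apply bounded_derivs_cst].
Qed.

Definition in_cell (w : list bool) (x : R) : Prop := left_pt w <= x <= right_pt w.

Lemma in_cell_param w x :
  in_cell w x ->
  exists s, unit_interval s /\ left_pt w + s / 2 ^ length w = x.
Proof.
unfold in_cell, right_pt; intros Hx; exists ((x - left_pt w) * 2 ^ length w).
assert (P : 0 < 2 ^ length w) by (apply pow_lt; lra).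
split; [|field; lra].
split; [apply Rmult_le_pos; lra |].
replace 1 with (/ 2 ^ length w * 2 ^ length w) by (field; lra).
apply Rmult_le_compat_r; lra.
Qed.

Lemma in_cell_unit w x : in_cell w x -> unit_interval x.
Proof.
unfold in_cell, unit_interval; assert (H := left_pt_bounds w); lra.
Qed.

Lemma in_cell_ends w : in_cell w (left_pt w) /\ in_cell w (right_pt w).
Proof. unfold in_cell, right_pt; assert (H := half_pow_pos (length w)); lra. Qed.

(** Measured from the left end of the cell, F is [gap] times a Moebius value with bounds of all
    orders, so [gap_mult_Derive_n] applies with j = 0. Two points are compared through the left end,
    whence the 2 in the constant. Arbitrary points are allowed for the sake of (iii). *)
Lemma Derive_n_F_cell k :
  exists C, 0 < C /\ forall w x y t, J t -> in_cell w x -> in_cell w y ->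
    Rabs (Derive_n (fun t => F t y) k t - Derive_n (fun t => F t x) k t)
    <= C * len_wt w ^ k * gap w t.
Proof.
destruct (gap_mult_Derive_n (fun i : list bool * {x | unit_interval x} => fst i) k 0
  (fun i t => moebius (skew (fst i) t) (F t (proj1_sig (snd i))))) as [C HC].
{ exact bounded_derivs_moebius. }
assert (HL : forall w x t, J t -> in_cell w x ->
  Rabs (Derive_n (fun t => F t x) k t - Derive_n (fun t => F t (left_pt w)) k t)
  <= C * len_wt w ^ k * gap w t).
{ intros w x t Ht Hx.
  assert (HU := in_cell_unit w x Hx).
  assert (HU' := in_cell_unit w _ (proj1 (in_cell_ends w))).
  destruct (in_cell_param w x Hx) as [s [Hs E]].
  assert (Hloc : forall x, unit_interval x ->
    locally t (fun s => forall j, (j <= k)%nat -> ex_derive_n (fun t => F t x) j s)).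
  { intros x0 Hx0; apply (filter_imp J); [|apply HJ, Ht].
    intros r Hr j _; apply ex_derive_n_F; assumption. }
  rewrite <- Derive_n_minus by auto.
  erewrite Derive_n_ext_loc; [exact (HC (w, exist _ s Hs) t Ht) |].
  apply (filter_imp J); [|apply HJ, Ht].
  intros r Hr; simpl.
  rewrite <- E, F_word, F_left_pt by assumption; ring. }
exists (2 * Rabs C + 1); split; [assert (H := Rabs_pos C); lra |].
intros w x y t Ht Hx Hy.
assert (Hg := gap_pos w t Ht).
assert (H1 := HL w x t Ht Hx); assert (H2 := HL w y t Ht Hy).
set (L := Derive_n (fun t => F t (left_pt w)) k t) in *.
replace (Derive_n (fun t => F t y) k t - Derive_n (fun t => F t x) k t)
  with ((Derive_n (fun t => F t y) k t - L) - (Derive_n (fun t => F t x) k t - L)) by ring.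
apply Rle_trans with (1 := Rabs_triang _ _); rewrite Rabs_Ropp.
assert (HCC := Rle_abs C).
assert (Hp : 0 <= len_wt w ^ k) by (apply pow_le, pos_INR).
assert (Hpg : 0 <= len_wt w ^ k * gap w t) by (apply Rmult_le_pos; lra).
rewrite Rmult_assoc in H1, H2 |- *; nra.
Qed.

(** Induction on n with 2^(-n) < y - x: if both points lie in one half, the functional equation
    doubles their distance and the Moebius maps preserve order; if 1/2 separates them, the values
    lie on either side of F(t, 1/2). *)
Lemma F_le x y t : J t -> 0 <= x <= y -> y <= 1 -> F t x <= F t y.
Proof.
intros Ht Hxy Hy.
destruct (Req_dec x y) as [-> | Hne]; [lra |].
destruct (pow_lt_1_zero (/ 2) ltac:(rewrite Rabs_right; lra) (y - x) ltac:(lra))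
  as [n Hn].
specialize (Hn n (le_n n)); rewrite Rabs_right, pow_inv in Hn
  by (apply Rle_ge, pow_le; lra).
revert x y Hxy Hy Hne Hn; induction n as [|n IH]; intros x y Hxy Hy Hne Hn;
  [simpl in Hn; lra |].
rewrite half_pow_S in Hn.
assert (HW : forall (d : bool) s, unit_interval s ->
  F t ((if d then / 2 else 0) + s / 2) =
  left_val [d] t + gap [d] t * moebius (skew [d] t) (F t s)).
{ intros d s Hs; rewrite <- F_word by assumption; simpl.
  f_equal; destruct d; field. }
assert (HI : forall (d : bool) s s', 0 <= s <= s' -> s' <= 1 -> F t s <= F t s' ->
  F t ((if d then / 2 else 0) + s / 2) <= F t ((if d then / 2 else 0) + s' / 2)).
{ intros d s s' Hs Hs' Hle; unfold unit_interval in *; rewrite !HW by lra.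
  assert (Hg := gap_pos [d] t Ht).
  assert (Hf := F_unit s t Ht ltac:(unfold unit_interval; lra)).
  assert (Hf' := F_unit s' t Ht ltac:(unfold unit_interval; lra)).
  apply Rplus_le_compat_l, Rmult_le_compat_l; [lra |].
  apply moebius_le; [apply skew_pos, Ht | lra | lra]. }
destruct (Rle_lt_dec y (/ 2)) as [Hy2 | Hy2];
  [| destruct (Rle_lt_dec x (/ 2)) as [Hx2 | Hx2]].
- assert (H := HI false (2 * x) (2 * y) ltac:(lra) ltac:(lra)).
  cbv iota in H.
  replace (0 + 2 * x / 2) with x in H by field.
  replace (0 + 2 * y / 2) with y in H by field.
  apply H, IH; lra.
- assert (H1 := F_word_bounds [false] (2 * x) t Ht ltac:(unfold unit_interval; lra)).
  assert (H2 := F_word_bounds [true] (2 * y - 1) t Ht ltac:(unfold unit_interval; lra)).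
  simpl length in H1, H2; simpl left_pt in H1, H2.
  replace (0 + 0 + 2 * x / 2 ^ 1) with x in H1 by field.
  replace (0 + / (2 * 1) + (2 * y - 1) / 2 ^ 1) with y in H2 by field.
  change (left_val [false] t) with (0 + 0) in H1.
  change (left_val [true] t) with (0 + gap [false] t) in H2.
  lra.
- assert (H := HI true (2 * x - 1) (2 * y - 1) ltac:(lra) ltac:(lra)).
  cbv iota in H.
  replace (/ 2 + (2 * x - 1) / 2) with x in H by field.
  replace (/ 2 + (2 * y - 1) / 2) with y in H by field.
  apply H, IH; lra.
Qed.

(** * Comparing cells with intervals *)

Lemma gap_le_increment w x y t :
  J t -> 0 <= x <= left_pt w -> right_pt w <= y <= 1 -> gap w t <= F t y - F t x.
Proof.
intros Ht Hx Hy; assert (Hw := left_pt_bounds w).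
assert (Hw' := in_cell_ends w); unfold in_cell in Hw'.
assert (H1 := F_le x (left_pt w) t Ht ltac:(lra) ltac:(lra)).
assert (H2 := F_le (right_pt w) y t Ht ltac:(lra) ltac:(lra)).
rewrite F_left_pt in H1 by exact Ht; rewrite F_right_pt in H2 by exact Ht; lra.
Qed.

Lemma word_of_index n (a : Z) :
  0 <= IZR a < 2 ^ n -> exists w, length w = n /\ left_pt w = IZR a / 2 ^ n.
Proof.
revert a; induction n as [|n IH]; intros a Ha.
- exists []; split; [reflexivity |]; simpl in *.
  assert (a = 0)%Z as ->; [|simpl; field].
  destruct Ha as [Ha1 Ha2]; apply le_IZR in Ha1; apply lt_IZR in Ha2; lia.
- assert (Hd := Z.div_mod a 2 ltac:(lia)); assert (Hr := Z.mod_pos_bound a 2 ltac:(lia)).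
  assert (P : 2 ^ n <> 0) by (apply pow_nonzero; lra).
  set (q := (a / 2)%Z) in *; set (r := (a mod 2)%Z) in *; clearbody q r.
  assert (HR : IZR a = 2 * IZR q + IZR r).
  { rewrite Hd, plus_IZR, mult_IZR; reflexivity. }
  simpl pow in Ha.
  assert (Hq : 0 <= IZR q < 2 ^ n).
  { split.
    - apply IZR_le; destruct Ha as [Ha _]; apply le_IZR in Ha; lia.
    - assert (0 <= IZR r) by (apply IZR_le; lia); lra. }
  destruct (IH q Hq) as [w [Hl Hw]].
  assert (Hc : r = 0%Z \/ r = 1%Z) by lia; destruct Hc as [-> | ->].
  + exists (false :: w); split; [simpl; lia |].
    cbn [left_pt]; rewrite Hw, HR; simpl; field; exact P.
  + exists (true :: w); split; [simpl; lia |].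
    cbn [left_pt]; rewrite Hw, Hl, HR; simpl; field; exact P.
Qed.

Lemma dyadic_scale d : 0 < d <= 1 -> exists n, / 2 ^ S n < d <= / 2 ^ n.
Proof.
intros Hd.
destruct (pow_lt_1_zero (/ 2) ltac:(rewrite Rabs_right; lra) d ltac:(lra)) as [N HN].
specialize (HN N (le_n N)); rewrite Rabs_right, pow_inv in HN
  by (apply Rle_ge, pow_le; lra).
induction N as [|N IH]; [simpl in HN; lra |].
destruct (Rle_lt_dec d (/ 2 ^ N)); [exists N; lra | auto].
Qed.

Lemma left_pt_repeat_false i w : left_pt (repeat false i ++ w) = left_pt w.
Proof. induction i as [|i IH]; simpl; [reflexivity | rewrite IH; ring]. Qed.

Lemma right_pt_repeat_true i w : right_pt (repeat true i ++ w) = right_pt w.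
Proof.
induction i as [|i IH]; [reflexivity |].
rewrite <- IH; unfold right_pt; cbn [repeat app left_pt length].
rewrite half_pow_S; field; apply pow_nonzero; lra.
Qed.

Lemma half_pow_length_repeat d i (w : list bool) :
  / 2 ^ length (repeat d i ++ w) = / 2 ^ i * / 2 ^ length w.
Proof.
rewrite length_app, repeat_length, pow_add, Rinv_mult; reflexivity.
Qed.

(** The cell is shrunk towards its left end until x lies in its right half. The left half then lies
    between [left_pt w] and x, and its [gap] is at least [share_min] times that of the shrunken
    cell. The depth of [w'] is not controlled. *)
Lemma left_end_cell w x t :
  J t -> in_cell w x -> left_pt w < x ->
  exists w', in_cell w' (left_pt w) /\ in_cell w' x /\
    share_min * gap w' t <= F t x - F t (left_pt w).
Proof.
intros Ht Hx Hlt; assert (HU := in_cell_unit w x Hx); unfold unit_interval in HU.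
destruct (in_cell_param w x Hx) as [s [Hs E]].
assert (P := half_pow_pos (length w)); assert (Hw := left_pt_bounds w).
assert (Hs0 : 0 < s).
{ destruct (Rle_lt_dec s 0); [|assumption].
  assert (0 <= (0 - s) * / 2 ^ length w) by (apply Rmult_le_pos; lra).
  unfold Rdiv in E; lra. }
destruct (dyadic_scale s) as [i Hi]; [unfold unit_interval in Hs; lra |].
exists (repeat false i ++ w).
assert (HL := left_pt_repeat_false i w); assert (HP := half_pow_length_repeat false i w).
assert (Hr : right_pt (repeat false i ++ w) = left_pt w + / 2 ^ i * / 2 ^ length w).
{ unfold right_pt; rewrite HL, HP; reflexivity. }
assert (Hr' : right_pt (false :: repeat false i ++ w)
    = left_pt w + / 2 ^ S i * / 2 ^ length w).
{ unfold right_pt; cbn [left_pt length]; rewrite !half_pow_S, HL, HP; field.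
  split; apply pow_nonzero; lra. }
unfold in_cell; rewrite HL, Hr, <- E; unfold Rdiv.
split; [|split].
- split; [lra | rewrite <- (Rplus_0_r (left_pt w)) at 1].
  apply Rplus_le_compat_l, Rmult_le_pos; lra.
- split; [|apply Rplus_le_compat_l, Rmult_le_compat_r; lra].
  rewrite <- (Rplus_0_r (left_pt w)) at 1.
  apply Rplus_le_compat_l, Rmult_le_pos; lra.
- apply Rle_trans with (1 := proj1 (gap_cons_bounds false (repeat false i ++ w) t Ht)).
  apply gap_le_increment; [exact Ht | cbn [left_pt]; rewrite HL; lra |].
  rewrite Hr'; unfold Rdiv in E.
  assert (/ 2 ^ S i * / 2 ^ length w <= s * / 2 ^ length w)
    by (apply Rmult_le_compat_r; lra).
  lra.
Qed.

(** Mirror image of [left_end_cell]: digits 1 keep the right end, and the relative distance 1 - s to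
    it sets the depth. *)
Lemma right_end_cell w x t :
  J t -> in_cell w x -> x < right_pt w ->
  exists w', in_cell w' (right_pt w) /\ in_cell w' x /\
    share_min * gap w' t <= F t (right_pt w) - F t x.
Proof.
intros Ht Hx Hlt; assert (HU := in_cell_unit w x Hx); unfold unit_interval in HU.
destruct (in_cell_param w x Hx) as [s [Hs E]].
assert (P := half_pow_pos (length w)); assert (Hw := left_pt_bounds w).
assert (HE : x = right_pt w - (1 - s) * / 2 ^ length w).
{ rewrite <- E; unfold right_pt, Rdiv; ring. }
assert (Hs0 : 0 < 1 - s).
{ destruct (Rle_lt_dec (1 - s) 0); [|assumption].
  assert (0 <= (s - 1) * / 2 ^ length w) by (apply Rmult_le_pos; lra); lra. }
destruct (dyadic_scale (1 - s)) as [i Hi]; [unfold unit_interval in Hs; lra |].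
exists (repeat true i ++ w).
assert (HR := right_pt_repeat_true i w); assert (HP := half_pow_length_repeat true i w).
assert (HR1 := right_pt_repeat_true (S i) w).
assert (HP1 := half_pow_length_repeat true (S i) w).
assert (Hl : left_pt (repeat true i ++ w) = right_pt w - / 2 ^ i * / 2 ^ length w).
{ rewrite <- HR, <- HP; unfold right_pt; ring. }
assert (Hl' : left_pt (true :: repeat true i ++ w)
    = right_pt w - / 2 ^ S i * / 2 ^ length w).
{ rewrite <- HR1, <- HP1; unfold right_pt; cbn [repeat app]; ring. }
change (repeat true (S i) ++ w) with (true :: repeat true i ++ w) in HR1.
unfold in_cell; rewrite HR, Hl.
assert ((1 - s) * / 2 ^ length w <= / 2 ^ i * / 2 ^ length w)
  by (apply Rmult_le_compat_r; lra).
assert (/ 2 ^ S i * / 2 ^ length w <= (1 - s) * / 2 ^ length w)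
  by (apply Rmult_le_compat_r; lra).
split; [lra | split; [lra |]].
apply Rle_trans with (1 := proj1 (gap_cons_bounds true (repeat true i ++ w) t Ht)).
apply gap_le_increment; [exact Ht | rewrite Hl'; lra | rewrite HR1; lra].
Qed.

(** * Increments over arbitrary intervals *)

(* Trades the level [j] of a dyadic cell, which may be much larger than [n], for
   [n]: the loss is compensated by the exponential decay of the cell's [F]-size. *)
Lemma level_absorption k :
  exists K, 0 < K /\ forall j n g tau,
    0 <= g <= (1 - share_min) ^ j -> share_min ^ 2 * g <= tau ->
    share_min ^ S (S n) <= tau ->
    INR (S j) ^ k * g <= K * INR (S n) ^ k * tau.
Proof.
assert (Hm := share_min_bounds); set (dl := share_min) in *; clearbody dl.
(* A base between 1 - dl and 1 that absorbs the power of j; below, N is chosen with eta^N < dl. *)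
set (eta := 1 - dl / 2).
destruct (polynomial_geometric_bound k (1 - dl) eta) as [C [PC HC]];
  [unfold eta; lra |].
destruct (pow_lt_1_zero eta ltac:(unfold eta; rewrite Rabs_right; lra) dl ltac:(lra))
  as [N HN].
specialize (HN N (le_n N)); rewrite Rabs_right in HN
  by (apply Rle_ge, pow_le; unfold eta; lra).
set (A := INR (2 * N + 1)).
assert (PA : 0 < A) by (apply lt_0_INR; lia).
assert (P2 : 0 < dl ^ 2) by (apply pow_lt; lra).
assert (PAk : 0 < A ^ k / dl ^ 2) by (apply Rdiv_lt_0_compat; [apply pow_lt |]; lra).
exists (C + A ^ k / dl ^ 2); split; [lra |].
intros j n g tau Hg Hgt Hn.
assert (Pt : 0 < tau) by (apply Rlt_le_trans with (2 := Hn), pow_lt; lra).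
assert (Hnk : 1 <= INR (S n) ^ k).
{ apply pow_R1_Rle; rewrite S_INR; assert (H := pos_INR n); lra. }
assert (Hj : 0 <= INR (S j) ^ k) by apply pow_le, pos_INR.
(* For j up to N (n + 2) one has j + 1 <= (2 N + 1) (n + 1), which explains A. Beyond that, eta^j <=
   dl^(n + 2) <= tau. *)
destruct (Nat.le_gt_cases j (N * S (S n))) as [Hle | Hgt'].
- assert (H1 : INR (S j) ^ k <= A ^ k * INR (S n) ^ k).
  { rewrite <- Rpow_mult_distr; apply pow_incr; split; [apply pos_INR |].
    unfold A; rewrite <- mult_INR; apply le_INR; nia. }
  assert (H2 : g <= tau / dl ^ 2).
  { apply (Rmult_le_reg_l (dl ^ 2)); [exact P2 |].
    replace (dl ^ 2 * (tau / dl ^ 2)) with tau by (field; lra); exact Hgt. }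
  apply Rle_trans with (A ^ k * INR (S n) ^ k * (tau / dl ^ 2)).
  + apply Rmult_le_compat; lra.
  + replace (A ^ k * INR (S n) ^ k * (tau / dl ^ 2))
      with (A ^ k / dl ^ 2 * (INR (S n) ^ k * tau)) by (field; lra).
    rewrite Rmult_assoc; apply Rmult_le_compat_r; [apply Rmult_le_pos |]; lra.
- assert (H1 : eta ^ j <= tau).
  { apply Rle_trans with (2 := Hn).
    apply Rle_trans with (eta ^ (N * S (S n))).
    - replace j with (N * S (S n) + (j - N * S (S n)))%nat at 1 by lia.
      rewrite pow_add.
      assert (Hp : 0 <= eta ^ (N * S (S n))) by (apply pow_le; unfold eta; lra).
      assert (Hq : eta ^ (j - N * S (S n)) <= 1).
      { rewrite <- (pow1 (j - N * S (S n))); apply pow_incr; unfold eta; lra. }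
      nra.
    - rewrite pow_mult; apply pow_incr; split; [apply pow_le; unfold eta; lra | lra]. }
  apply Rle_trans with (INR (S j) ^ k * (1 - dl) ^ j); [apply Rmult_le_compat_l; lra |].
  apply Rle_trans with (1 := HC j).
  apply Rle_trans with (C * tau); [apply Rmult_le_compat_l; lra |].
  apply Rmult_le_compat_r; [lra |].
  assert (C * 1 <= C * INR (S n) ^ k) by (apply Rmult_le_compat_l; lra).
  assert (0 <= A ^ k / dl ^ 2 * INR (S n) ^ k) by (apply Rmult_le_pos; lra).
  lra.
Qed.

(** An interval longer than two cells of level n + 2 contains the cell that follows the one of x. *)
Lemma F_increment_lower n x y t :
  J t -> 0 <= x -> y <= 1 -> / 2 ^ S n < y - x ->
  share_min ^ S (S n) <= F t y - F t x.
Proof.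
intros Ht Hx Hy Hxy.
assert (P : 0 < 2 ^ S (S n)) by (apply pow_lt; lra).
destruct (base_Int_part (2 ^ S (S n) * x)) as [I1 I2].
set (a := Int_part (2 ^ S (S n) * x)) in *; clearbody a.
assert (E : / 2 ^ S n * 2 ^ S (S n) = 2) by (simpl; field; apply pow_nonzero; lra).
assert (Hxy' : 2 < (y - x) * 2 ^ S (S n)).
{ apply Rle_lt_trans with (/ 2 ^ S n * 2 ^ S (S n)); [lra |].
  apply Rmult_lt_compat_r; assumption. }
assert (Hy' : y * 2 ^ S (S n) <= 1 * 2 ^ S (S n)) by (apply Rmult_le_compat_r; lra).
assert (Hx' : 0 <= 2 ^ S (S n) * x) by (apply Rmult_le_pos; lra).
destruct (word_of_index (S (S n)) (a + 1)) as [w [Hl Hw]];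
  [rewrite plus_IZR; lra |].
assert (HG := gap_bounds w t Ht); rewrite Hl in HG.
apply Rle_trans with (1 := proj1 HG), gap_le_increment; [exact Ht | |].
- split; [exact Hx |]; rewrite Hw, plus_IZR.
  apply (Rmult_le_reg_r (2 ^ S (S n))); [exact P |].
  unfold Rdiv; rewrite (Rmult_assoc (IZR a + 1)), Rinv_l by lra; lra.
- split; [|exact Hy]; unfold right_pt; rewrite Hl, Hw, plus_IZR.
  apply (Rmult_le_reg_r (2 ^ S (S n))); [exact P |].
  unfold Rdiv; rewrite Rmult_plus_distr_r, (Rmult_assoc (IZR a + 1)), Rinv_l by lra; lra.
Qed.

(** More than half of a cell contains its second or its third quarter, two levels down, whence the
    square. *)
Lemma gap_le_half_cell_increment w s s' t :
  J t -> 0 <= s -> s' <= 1 -> / 2 < s' - s ->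
  share_min ^ 2 * gap w t <=
  F t (left_pt w + s' / 2 ^ length w) - F t (left_pt w + s / 2 ^ length w).
Proof.
intros Ht Hs Hs' Hd; assert (Hm := share_min_bounds).
assert (P := half_pow_pos (length w)); assert (Hw := left_pt_bounds w).
unfold right_pt, Rdiv in *.
assert (HG : forall d d', share_min ^ 2 * gap w t <= gap (d :: d' :: w) t).
{ intros d d'; assert (H1 := gap_cons_bounds d' w t Ht).
  assert (H2 := gap_cons_bounds d (d' :: w) t Ht).
  apply Rle_trans with (2 := proj1 H2).
  replace (share_min ^ 2 * gap w t) with (share_min * (share_min * gap w t)) by ring.
  apply Rmult_le_compat_l; lra. }
assert (Hmul : forall c c', c <= c' -> c * / 2 ^ length w <= c' * / 2 ^ length w).
{ intros c c' Hc; apply Rmult_le_compat_r; lra. }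
assert (Hp0 := Hmul 0 s Hs); assert (Hp1 := Hmul s' 1 Hs').
destruct (Rle_lt_dec s (/ 4)) as [H4 | H4].
- apply Rle_trans with (1 := HG true false), gap_le_increment; [exact Ht | |];
    unfold right_pt; cbn [left_pt length]; rewrite !half_pow_S.
  + assert (H := Hmul s (/ 4) H4); lra.
  + assert (H := Hmul (/ 2) s' ltac:(lra)); lra.
- apply Rle_trans with (1 := HG false true), gap_le_increment; [exact Ht | |];
    unfold right_pt; cbn [left_pt length]; rewrite !half_pow_S.
  + assert (H := Hmul s (/ 2) ltac:(lra)); lra.
  + assert (H := Hmul (3 / 4) s' ltac:(lra)); lra.
Qed.

(** For 2^(-n-1) < y - x <= 2^(-n) the interval meets at most two adjacent cells of level n, and the
    2 in the constant counts them. Positivity of the increment is delivered as well, for the later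
    division. *)
Lemma Derive_n_F_increment k :
  exists C, 0 < C /\ forall x y t, J t -> 0 <= x < y -> y <= 1 ->
    0 < F t y - F t x /\
    exists n, y - x <= / 2 ^ n /\
      Rabs (Derive_n (fun t => F t y) k t - Derive_n (fun t => F t x) k t)
      <= C * INR (S n) ^ k * (F t y - F t x).
Proof.
destruct (Derive_n_F_cell k) as [C [PC HC]].
destruct (level_absorption k) as [K [PK HK]].
assert (Hm := share_min_bounds).
exists (2 * (C * K)); split; [assert (0 < C * K) by (apply Rmult_lt_0_compat; lra); lra |].
intros x y t Ht Hx Hy.
destruct (dyadic_scale (y - x)) as [n [Hn1 Hn2]]; [lra |].
assert (Hlow := F_increment_lower n x y t Ht (proj1 Hx) Hy Hn1).
set (tau := F t y - F t x) in *.
assert (Pt : 0 < tau) by (apply Rlt_le_trans with (2 := Hlow), pow_lt; lra).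
split; [exact Pt |]; exists n; split; [exact Hn2 |].
set (H := fun z => Derive_n (fun t => F t z) k t).
change (Rabs (H y - H x) <= 2 * (C * K) * INR (S n) ^ k * tau).
assert (HCK : forall w z z', in_cell w z -> in_cell w z' ->
  share_min ^ 2 * gap w t <= tau ->
  Rabs (H z' - H z) <= C * K * INR (S n) ^ k * tau).
{ intros w z z' Hz Hz' Hw.
  apply Rle_trans with (1 := HC w z z' t Ht Hz Hz').
  rewrite !Rmult_assoc; apply Rmult_le_compat_l; [lra |].
  rewrite <- Rmult_assoc; apply (HK (length w) n (gap w t) tau); [| exact Hw | exact Hlow].
  assert (Hg := gap_pos w t Ht); split; [lra | apply gap_bounds, Ht]. }
assert (HB : forall w, share_min * gap w t <= tau -> share_min ^ 2 * gap w t <= tau).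
{ intros w Hw; assert (Hg := gap_pos w t Ht).
  assert (0 < share_min * gap w t) by (apply Rmult_lt_0_compat; lra).
  simpl; nra. }
assert (P0 : 0 <= C * K * INR (S n) ^ k * tau).
{ repeat apply Rmult_le_pos; try lra; apply pow_le, pos_INR. }
assert (P : 0 < 2 ^ n) by (apply pow_lt; lra).
assert (E : / 2 ^ n * 2 ^ n = 1) by (apply Rinv_l; lra).
destruct (base_Int_part (2 ^ n * x)) as [I1 I2].
set (a := Int_part (2 ^ n * x)) in *; clearbody a.
assert (Hx0 : 0 <= 2 ^ n * x) by (apply Rmult_le_pos; lra).
assert (Hxn : 2 ^ n * x < 2 ^ n * y) by (apply Rmult_lt_compat_l; lra).
assert (Hyn : 2 ^ n * y <= 2 ^ n * 1) by (apply Rmult_le_compat_l; lra).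
assert (Ha0 : 0 <= IZR a).
{ apply IZR_le, Zlt_succ_le, lt_IZR; unfold Z.succ; rewrite plus_IZR; lra. }
destruct (word_of_index n a) as [w [Hl Hw]]; [lra |].
assert (HcellL : forall z, IZR a <= 2 ^ n * z <= IZR a + 1 -> in_cell w z).
{ intros z Hz; unfold in_cell, right_pt; rewrite Hl, Hw.
  replace z with (2 ^ n * z / 2 ^ n) by (field; lra).
  replace (IZR a / 2 ^ n + / 2 ^ n) with ((IZR a + 1) / 2 ^ n) by (field; lra).
  split; apply Rmult_le_compat_r; lra. }
destruct (Rle_lt_dec (2 ^ n * y) (IZR a + 1)) as [Hya | Hya].
- assert (HcX := HcellL x ltac:(lra)); assert (HcY := HcellL y ltac:(lra)).
  assert (HG : share_min ^ 2 * gap w t <= tau).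
  { assert (HG := gap_le_half_cell_increment w (2 ^ n * x - IZR a) (2 ^ n * y - IZR a) t
      Ht ltac:(lra) ltac:(lra)).
    rewrite Hl, Hw in HG.
    replace (IZR a / 2 ^ n + (2 ^ n * x - IZR a) / 2 ^ n) with x in HG by (field; lra).
    replace (IZR a / 2 ^ n + (2 ^ n * y - IZR a) / 2 ^ n) with y in HG by (field; lra).
    apply HG.
    assert (HS : 2 ^ n * / 2 ^ S n < 2 ^ n * (y - x)) by (apply Rmult_lt_compat_l; lra).
    rewrite half_pow_S in HS; lra. }
  assert (HF' := HCK w x y HcX HcY HG); lra.
(* The interval is cut at the common endpoint [left_pt w']; each piece gets a cell of its own scale,
   and both pieces have increments at most tau by monotonicity. *)
- destruct (word_of_index n (a + 1)) as [w' [Hl' Hw']]; [rewrite plus_IZR; lra |].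
  rewrite plus_IZR in Hw'.
  assert (Hm1 : right_pt w = left_pt w').
  { unfold right_pt; rewrite Hl, Hw, Hw'; field; lra. }
  assert (Em : 2 ^ n * left_pt w' = IZR a + 1) by (rewrite Hw'; field; lra).
  assert (HxM : x < left_pt w').
  { apply (Rmult_lt_reg_l (2 ^ n)); lra. }
  assert (HMy : left_pt w' < y).
  { apply (Rmult_lt_reg_l (2 ^ n)); lra. }
  assert (HcX := HcellL x ltac:(lra)).
  assert (HcY : in_cell w' y).
  { unfold in_cell, right_pt; rewrite Hl'; lra. }
  destruct (left_end_cell w' y t Ht HcY HMy) as [w1 [A1 [A2 A3]]].
  destruct (right_end_cell w x t Ht HcX ltac:(lra)) as [w2 [D1 [D2 D3]]].
  rewrite Hm1 in D1, D3.
  assert (L1 := F_le x (left_pt w') t Ht ltac:(lra) ltac:(lra)).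
  assert (L2 := F_le (left_pt w') y t Ht ltac:(lra) Hy).
  assert (T1 := HCK w1 _ y A1 A2 (HB w1 ltac:(unfold tau; lra))).
  assert (T2 := HCK w2 x _ D2 D1 (HB w2 ltac:(unfold tau; lra))).
  replace (H y - H x) with ((H y - H (left_pt w')) + (H (left_pt w') - H x)) by ring.
  apply Rle_trans with (1 := Rabs_triang _ _); lra.
Qed.

End BoundedDerivatives.

(** * Uniform constants near t = 0 and the theorem *)

Lemma le_log2_of_dyadic_bound n d : 0 < d <= / 2 ^ n -> INR n <= - log2 d.
Proof.
intros Hd; unfold log2.
assert (L2 : 0 < ln 2) by (rewrite <- ln_1; apply ln_increasing; lra).
assert (P : 0 < 2 ^ n) by (apply pow_lt; lra).
assert (H : ln d <= ln (/ 2 ^ n)).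
{ destruct (Req_dec d (/ 2 ^ n)) as [-> | Hne]; [lra |].
  left; apply ln_increasing; lra. }
rewrite ln_Rinv, ln_pow in H by lra.
apply (Rmult_le_reg_r (ln 2)); [exact L2 |].
replace (- (ln d / ln 2) * ln 2) with (- ln d) by (field; lra); lra.
Qed.

(** Each derivative is continuous on the compact interval [-e, e], hence bounded there. The
    induction treats all derivatives of f at once. *)
Lemma smooth_bounded_derivs (J : R -> Prop) (f : R -> R) e k :
  0 < e -> smooth_on (fun t => - e <= t <= e) f -> (forall t, J t -> - e <= t <= e) ->
  open J -> bounded_derivs J k unit_wt (fun _ : unit => f).
Proof.
intros He Hf HJe HJ.
assert (H : forall j, bounded_derivs J k unit_wt (fun _ : unit => Derive_n f j));
  [|exact (H 0%nat)].
assert (HB : forall j, exists M, forall (i : unit) t, J t ->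
  Rabs (Derive_n f j t) <= M * unit_wt i).
{ intros j.
  destruct (continuity_ab_maj (fun t => Rabs (Derive_n f j t)) (- e) e) as [m [Hm _]];
    [lra | |].
  - intros t Ht; apply (continuity_pt_comp (Derive_n f j) Rabs); [|apply Rcontinuity_abs].
    apply continuity_pt_filterlim, (ex_derive_continuous (V := R_NormedModule)).
    exact (Hf (S j) t Ht).
  - exists (Rabs (Derive_n f j m)); intros i t Ht; unfold unit_wt.
    rewrite Rmult_1_r; apply Hm, HJe, Ht. }
induction k as [|k IH]; intros j; [split; [apply HB | exact Logic.I] |].
apply (bounded_derivs_of_derive J HJ k _ _ (fun _ => Derive_n f (S j)));
  [apply HB | | apply IH].
intros i t Ht; apply Derive_correct; exact (Hf (S j) t (HJe t Ht)).
Qed.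

(** Membership in E gives B < 1 + U < 1/B and 1 - B < 1 + V < 1/(1 - B), so controlling four
    quantities from below is enough. *)
Lemma param_set_E_bounds B U V kap :
  param_set_E B U V -> 0 < kap -> kap <= B -> kap <= 1 - B ->
  kap <= 1 - B * (1 + U) -> kap <= B + V ->
  kap <= B /\ kap <= 1 - B /\ kap <= 1 + U <= / kap /\
  kap <= 1 + V <= / kap /\ kap <= 1 - B * (1 + U) /\ kap <= B + V.
Proof.
intros (HB & HU & HV & _) Hk H1 H2 H3 H4.
assert (HiB : 1 / B <= / kap).
{ unfold Rdiv; rewrite Rmult_1_l; apply Rinv_le_contravar; lra. }
assert (HiB' : 1 + B / (1 - B) <= / kap).
{ replace (1 + B / (1 - B)) with (/ (1 - B)) by (field; lra).
  apply Rinv_le_contravar; lra. }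
repeat split; lra.
Qed.

Lemma positive_near_0 (f : R -> R) :
  ex_derive f 0 -> 0 < f 0 -> locally 0 (fun t => f 0 / 2 < f t).
Proof.
intros Hf Hp; apply (ex_derive_continuous (V := R_NormedModule)) in Hf.
apply (Hf (fun z => f 0 / 2 < z)); apply (open_gt (f 0 / 2)); lra.
Qed.

Lemma locally_0_interval (P : R -> Prop) :
  locally 0 P -> exists e, 0 < e /\ forall t, - e <= t <= e -> P t.
Proof.
intros [r Hr]; assert (Hp := cond_pos r); exists (r / 2); split; [lra |].
intros t Ht; apply Hr; apply Rabs_def1; unfold minus, plus, opp; simpl; lra.
Qed.

Lemma open_ext_open_interval lo hi : open (ext_open_interval lo hi).
Proof. apply open_and; [apply open_Rbar_gt | apply open_Rbar_lt]. Qed.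

Lemma uniform_params_near_0 lo hi (hI : ext_open_interval lo hi 0) (B U V : R -> R) :
  smooth_on (ext_open_interval lo hi) B -> smooth_on (ext_open_interval lo hi) U ->
  smooth_on (ext_open_interval lo hi) V ->
  (forall t, ext_open_interval lo hi t -> param_set_E (B t) (U t) (V t)) ->
  exists e kap, 0 < e /\ 0 < kap < 1 /\
    (forall t, - e <= t <= e -> ext_open_interval lo hi t) /\
    forall t, - e <= t <= e ->
      kap <= B t /\ kap <= 1 - B t /\ kap <= 1 + U t <= / kap /\
      kap <= 1 + V t <= / kap /\ kap <= 1 - B t * (1 + U t) /\ kap <= B t + V t.
Proof.
intros hB hU hV hE.
assert (DB : ex_derive B 0) by exact (hB 1%nat 0 hI).
assert (DU : ex_derive U 0) by exact (hU 1%nat 0 hI).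
assert (DV : ex_derive V 0) by exact (hV 1%nat 0 hI).
destruct (hE 0 hI) as (HB & HU & HV & _).
assert (HL : 0 < 1 - B 0 * (1 + U 0)).
{ assert (B 0 * (1 + U 0) < B 0 * (1 / B 0)) by (apply Rmult_lt_compat_l; lra).
  replace (B 0 * (1 / B 0)) with 1 in H by (field; lra); lra. }
assert (L1 := positive_near_0 B DB ltac:(lra)).
assert (L2 := positive_near_0 (fun t => 1 - B t)
  ltac:(auto_derive; auto) ltac:(simpl; lra)).
assert (L3 := positive_near_0 (fun t => 1 - B t * (1 + U t))
  ltac:(auto_derive; auto) ltac:(simpl; lra)).
assert (L4 := positive_near_0 (fun t => B t + V t)
  ltac:(auto_derive; auto) ltac:(simpl; lra)).
destruct (locally_0_interval _ (filter_and _ _ (open_ext_open_interval lo hi 0 hI)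
  (filter_and _ _ (filter_and _ _ L1 L2) (filter_and _ _ L3 L4)))) as [e [He Hloc]].
(* By continuity each of the four quantities stays above half of its value at 0; [kap] is the least
   of these halves. *)
set (kap := Rmin (Rmin (B 0 / 2) ((1 - B 0) / 2))
  (Rmin ((1 - B 0 * (1 + U 0)) / 2) ((B 0 + V 0) / 2))).
assert (K1 : kap <= Rmin (B 0 / 2) ((1 - B 0) / 2)) by apply Rmin_l.
assert (K2 : kap <= Rmin ((1 - B 0 * (1 + U 0)) / 2) ((B 0 + V 0) / 2)) by apply Rmin_r.
assert (K3 := Rmin_l (B 0 / 2) ((1 - B 0) / 2)).
assert (K4 := Rmin_r (B 0 / 2) ((1 - B 0) / 2)).
assert (K5 := Rmin_l ((1 - B 0 * (1 + U 0)) / 2) ((B 0 + V 0) / 2)).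
assert (K6 := Rmin_r ((1 - B 0 * (1 + U 0)) / 2) ((B 0 + V 0) / 2)).
assert (Kp : 0 < kap) by (unfold kap; repeat apply Rmin_glb_lt; lra).
exists e, kap; split; [exact He | split; [lra | split]].
- intros t Ht; apply (Hloc t Ht).
- intros t Ht; destruct (Hloc t Ht) as [Hi [[G1 G2] [G3 G4]]].
  apply param_set_E_bounds; [apply hE, Hi | exact Kp | lra ..].
Qed.

Theorem theorem2p6
  (lo hi : Rbar) (hI : ext_open_interval lo hi 0)
  (b1 c0 c1 : R -> R)
  (hb1 : smooth_on (ext_open_interval lo hi) b1)
  (hc0 : smooth_on (ext_open_interval lo hi) c0)
  (hc1 : smooth_on (ext_open_interval lo hi) c1)
  (hE : forall t, ext_open_interval lo hi t -> param_set_E (b1 t) (c0 t) (c1 t))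
  (F : R -> R -> R)
  (hF : forall t, ext_open_interval lo hi t ->
    de_rham_solution (mat_A0 (b1 t) (c0 t) (c1 t)) (mat_A1 (b1 t) (c0 t) (c1 t)) (F t)) :
  (forall k : nat, exists C : R,
    0 < C /\
    (forall (x : R) (n : nat), 0 <= x < 1 -> (1 <= n)%nat ->
      Rabs ((dF F k (digit_trunc n x + / 2 ^ n) - dF F k (digit_trunc n x)) /
            (F 0 (digit_trunc n x + / 2 ^ n) - F 0 (digit_trunc n x)))
      <= C * INR n ^ k) /\
    (forall x y : R,
      unit_interval x -> unit_interval y -> x <> y ->
      Rabs ((dF F k x - dF F k y) / (F 0 x - F 0 y))
      <= C * Rmax 1 (- log2 (Rabs (x - y))) ^ k)) /\
  (forall (k : nat) (x : R),
    unit_interval x -> ~ dyadic_interior x ->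
    kth_derivative_well_defined (fun t => F t x) k 0).
Proof.
destruct (uniform_params_near_0 lo hi hI b1 c0 c1 hb1 hc0 hc1 hE)
  as (e & kap & He & Hkap & HI & Hpar).
set (J := fun t : R => - e < t < e).
assert (HJ : open J) by (apply open_and; [apply open_gt | apply open_lt]).
assert (HJI : forall t, J t -> - e <= t <= e) by (unfold J; intros; lra).
assert (H0 : J 0) by (unfold J; lra).
assert (HS : forall f, smooth_on (ext_open_interval lo hi) f ->
  forall k, bounded_derivs J k unit_wt (fun _ : unit => f)).
{ intros f Hf k; apply (smooth_bounded_derivs J f e k); auto.
  intros n t Ht; auto. }
assert (Hb := HS _ hb1); assert (Hu := HS _ hc0); assert (Hv := HS _ hc1).
assert (HparJ := fun t Ht => Hpar t (HJI t Ht)).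
assert (HFJ := fun t Ht => hF t (HI t (HJI t Ht))).
split.
- intros k.
  destruct (Derive_n_F_cell J HJ b1 c0 c1 kap Hkap HparJ Hb Hu Hv F HFJ k)
    as [C1 [PC1 HC1]].
  destruct (Derive_n_F_increment J HJ b1 c0 c1 kap Hkap HparJ Hb Hu Hv F HFJ k)
    as [C2 [PC2 HC2]].
  assert (P2k : 0 < 2 ^ k) by (apply pow_lt; lra).
  (* One constant for both estimates: C1 serves (i) and C2 serves (iii). The factor 2^k turns n + 1
     into n, as n >= 1 in (i), and into the maximum of 1 and -log_2 |x - y| in (iii), where n may be
     0. *)
  exists (2 ^ k * (C1 + C2)); split; [apply Rmult_lt_0_compat; lra | split].
  + intros x n Hx Hn.
    rewrite digit_trunc_floor by exact Hx.
    assert (P : 0 < 2 ^ n) by (apply pow_lt; lra).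
    assert (Hx0 : 0 <= 2 ^ n * x) by (apply Rmult_le_pos; lra).
    assert (Hx1 : 2 ^ n * x < 2 ^ n * 1) by (apply Rmult_lt_compat_l; lra).
    destruct (base_Int_part (2 ^ n * x)) as [I1 I2].
    set (a := Int_part (2 ^ n * x)) in *; clearbody a.
    destruct (word_of_index n a) as [w [Hl Hw]].
    { split; [|lra].
      apply IZR_le, Zlt_succ_le, lt_IZR; unfold Z.succ; rewrite plus_IZR; lra. }
    assert (HR : right_pt w = IZR a * / 2 ^ n + / 2 ^ n).
    { unfold right_pt; rewrite Hl, Hw; reflexivity. }
    change (IZR a / 2 ^ n) with (IZR a * / 2 ^ n) in Hw.
    rewrite <- HR, <- Hw.
    destruct (in_cell_ends w) as [W1 W2].
    assert (HC := HC1 w _ _ 0 H0 W1 W2).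
    assert (Hg := gap_pos J b1 c0 c1 kap Hkap HparJ w 0 H0).
    rewrite (F_right_pt J b1 c0 c1 kap Hkap HparJ F HFJ w 0 H0),
      (F_left_pt J b1 c0 c1 kap Hkap HparJ F HFJ w 0 H0).
    replace (left_val b1 c0 c1 w 0 + gap b1 c0 c1 w 0 - left_val b1 c0 c1 w 0)
      with (gap b1 c0 c1 w 0) by ring.
    rewrite Rabs_div, (Rabs_right (gap _ _ _ _ _)) by lra.
    apply (Rmult_le_reg_r (gap b1 c0 c1 w 0)); [exact Hg |].
    unfold Rdiv; rewrite Rmult_assoc, Rinv_l, Rmult_1_r by lra.
    apply Rle_trans with (1 := HC), Rmult_le_compat_r; [lra |].
    assert (Hk : len_wt w ^ k <= 2 ^ k * INR n ^ k).
    { rewrite <- Rpow_mult_distr; apply pow_incr; unfold len_wt; rewrite Hl, S_INR.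
      assert (1 <= INR n) by (apply (le_INR 1); exact Hn); lra. }
    assert (Hp : 0 <= INR n ^ k) by apply pow_le, pos_INR.
    assert (0 <= 2 ^ k * INR n ^ k) by (apply Rmult_le_pos; lra).
    replace (2 ^ k * (C1 + C2) * INR n ^ k)
      with (C1 * (2 ^ k * INR n ^ k) + C2 * (2 ^ k * INR n ^ k)) by ring.
    assert (0 <= C2 * (2 ^ k * INR n ^ k)) by (apply Rmult_le_pos; lra).
    assert (C1 * len_wt w ^ k <= C1 * (2 ^ k * INR n ^ k))
      by (apply Rmult_le_compat_l; lra).
    lra.
  + assert (HW : forall x y, 0 <= x < y -> y <= 1 ->
      Rabs ((dF F k y - dF F k x) / (F 0 y - F 0 x))
      <= 2 ^ k * (C1 + C2) * Rmax 1 (- log2 (y - x)) ^ k).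
    { intros x y Hxy Hy.
      destruct (HC2 x y 0 H0 Hxy Hy) as [Ht [n [Hn HC]]].
      rewrite Rabs_div, (Rabs_right (F 0 y - F 0 x)) by lra.
      apply (Rmult_le_reg_r (F 0 y - F 0 x)); [exact Ht |].
      unfold Rdiv; rewrite Rmult_assoc, Rinv_l, Rmult_1_r by lra.
      apply Rle_trans with (1 := HC), Rmult_le_compat_r; [lra |].
      set (N := Rmax 1 (- log2 (y - x))).
      assert (N1 : 1 <= N) by apply Rmax_l.
      assert (Nn : INR n <= N).
      { apply Rle_trans with (2 := Rmax_r _ _), le_log2_of_dyadic_bound; lra. }
      assert (Hk : INR (S n) ^ k <= 2 ^ k * N ^ k).
      { rewrite <- Rpow_mult_distr; apply pow_incr; rewrite S_INR.
        assert (H := pos_INR n); lra. }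
      assert (Hp : 0 <= N ^ k) by (apply pow_le; lra).
      assert (0 <= 2 ^ k * N ^ k) by (apply Rmult_le_pos; lra).
      replace (2 ^ k * (C1 + C2) * N ^ k)
        with (C1 * (2 ^ k * N ^ k) + C2 * (2 ^ k * N ^ k)) by ring.
      assert (0 <= C1 * (2 ^ k * N ^ k)) by (apply Rmult_le_pos; lra).
      assert (C2 * INR (S n) ^ k <= C2 * (2 ^ k * N ^ k))
        by (apply Rmult_le_compat_l; lra).
      lra. }
    intros x y Hx Hy Hxy; unfold unit_interval in *.
    destruct (Rtotal_order x y) as [Hlt | [-> | Hlt]]; [| lra |].
    * assert (Ht := proj1 (HC2 x y 0 H0 ltac:(lra) ltac:(lra))).
      replace ((dF F k x - dF F k y) / (F 0 x - F 0 y))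
        with ((dF F k y - dF F k x) / (F 0 y - F 0 x)) by (field; lra).
      rewrite Rabs_minus_sym, (Rabs_right (y - x)) by lra; apply HW; lra.
    * rewrite (Rabs_right (x - y)) by lra; apply HW; lra.
- intros k x Hx _.
  assert (HD : forall j t, J t -> ex_derive_n (fun t => F t x) j t).
  { intros j t Ht.
    apply (ex_derive_n_F J HJ b1 c0 c1 kap Hkap HparJ Hb Hu Hv F HFJ); assumption. }
  split; [|apply HD, H0].
  (* The lower derivatives exist on all of [J], a neighbourhood of 0. *)
  apply (filter_imp J); [intros s Hs j _; auto | apply HJ, H0].
Qed.
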